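(* Let $\mathcal{B}$ be a Frobenius abelian category (it has enough projective and enough injective objects, and projective objects coincide with injective objects). Let $\mathsf{F}:\mathcal{B}\to\mathcal{B}$ be an additive exact functor with $\mathsf{F}^2=0$ which preserves projective objects and admits a right adjoint functor $\mathsf{G}$. Let $\mathcal{A}=\mathcal{B}\ltimes\mathsf{F}$ be the right trivial extension. Then: (1) $\mathcal{A}$ is a Gorenstein abelian category with $\mathrm{FPD}(\mathcal{A})=\mathrm{FID}(\mathcal{A})\le 1$, and $${}_{\mathcal{A}}\mathcal{P}^{<\infty}={}_{\mathcal{A}}\mathcal{P}^{\le 1}=\mathsf{U}^{-1}({}_{\mathcal{B}}\mathcal{P})=\mathsf{U}^{-1}({}_{\mathcal{B}}\mathcal{I})={}_{\mathcal{A}}\mathcal{I}^{\le 1}={}_{\mathcal{A}}\mathcal{I}^{<\infty}.$$ (2) $({}^{\perp}\mathsf{U}^{-1}({}_{\mathcal{B}}\mathcal{I}),\mathsf{U}^{-1}({}_{\mathcal{B}}\mathcal{I}))=(\Delta(\mathcal{B}),\Delta(\mathcal{B})^{\perp})=(\mathrm{GP}(\mathcal{A}),{}_{\mathcal{A}}\mathcal{P}^{\le 1})$, and this is a hereditary complete cotorsion pair in $\mathcal{A}$. In particular, $\mathrm{GP}(\mathcal{A})=\Delta(\mathcal{B})$.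
   Context: The right trivial extension $\mathcal{B}\ltimes\mathsf{F}$ has as objects the pairs $(X,f)$ with $X\in\mathcal{B}$ and $f:\mathsf{F}(X)\to X$ such that $f\circ\mathsf{F}(f)=0$ (automatic when $\mathsf{F}^2=0$); a morphism $(X,f)\to(Y,g)$ is a morphism $\alpha:X\to Y$ in $\mathcal{B}$ with $\alpha\circ f=g\circ\mathsf{F}(\alpha)$. It is an abelian category with exactness computed in $\mathcal{B}$; here it has enough projectives and (because $\mathsf{F}$ has a right adjoint) enough injectives. For a class $\mathcal{X}$ of objects of $\mathcal{B}$: $\mathsf{U}^{-1}(\mathcal{X})=\{(X,f) : X\in\mathcal{X}\}$, and, since $\mathsf{F}^2=0$, $\Delta(\mathcal{X})=\{(X,f) : f\text{ is a monomorphism and }\mathrm{Coker}(f)\in\mathcal{X}\}$; thus $\Delta(\mathcal{B})$ is the class of $(X,f)$ with $f$ a monomorphism. For an abelian category $\mathcal{A}$ with enough projectives and injectives: ${}_{\mathcal{A}}\mathcal{P}$, ${}_{\mathcal{A}}\mathcal{I}$ are the classes of projective and injective objects; ${}_{\mathcal{A}}\mathcal{P}^{<\infty}$, ${}_{\mathcal{A}}\mathcal{I}^{<\infty}$ the classes of objects of finite projective, respectively finite injective, dimension; ${}_{\mathcal{A}}\mathcal{P}^{\le 1}$, ${}_{\mathcal{A}}\mathcal{I}^{\le 1}$ the classes of objects of projective, respectively injective, dimension at most $1$. $\mathrm{FPD}(\mathcal{A})$ is the supremum of projective dimensions of objects in ${}_{\mathcal{A}}\mathcal{P}^{<\infty}$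 and $\mathrm{FID}(\mathcal{A})$ the supremum of injective dimensions of objects in ${}_{\mathcal{A}}\mathcal{I}^{<\infty}$. $\mathcal{A}$ is Gorenstein if the supremum of the projective dimensions of injective objects and the supremum of the injective dimensions of projective objects are both finite. An object $X$ is Gorenstein projective if $X=\mathrm{Im}(P^{-1}\to P^0)$ for some acyclic complex $P^\bullet$ of projectives such that $\mathrm{Hom}_{\mathcal{A}}(P^\bullet,Q)$ is acyclic for every projective $Q$; $\mathrm{GP}(\mathcal{A})$ is the class of Gorenstein projective objects. For a class $\mathcal{S}$ of objects: ${}^{\perp}\mathcal{S}=\{Y : \mathrm{Ext}^1_{\mathcal{A}}(Y,S)=0\ \forall S\in\mathcal{S}\}$, $\mathcal{S}^{\perp}=\{Y : \mathrm{Ext}^1_{\mathcal{A}}(S,Y)=0\ \forall S\in\mathcal{S}\}$. A pair $(\mathcal{C},\mathcal{D})$ is a cotorsion pair if $\mathcal{C}={}^{\perp}\mathcal{D}$ and $\mathcal{D}=\mathcal{C}^{\perp}$; it is complete if for every object $A$ there are exact sequences $0\to D\to C\to A\to0$ and $0\to A\to D'\to C'\to0$ with $C,C'\in\mathcal{C}$, $D,D'\in\mathcal{D}$; it is hereditary if $\mathrm{Ext}^i_{\mathcal{A}}(C,D)=0$ for all $i\ge1$, $C\in\mathcal{C}$, $D\in\mathcal{D}$. *)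

(* Defs.v *)
From HB Require Import structures.
From mathcomp Require Import all_boot all_order all_algebra.
From mathcomp Require Import boolp classical_sets.

Set Implicit Arguments.
Unset Strict Implicit.
Unset Printing Implicit Defensive.

Import Order.TTheory GRing.Theory.
Local Open Scope classical_set_scope.
Local Open Scope ring_scope.

Record preadditive := Preadditive {
  obj :> Type;
  hom : obj -> obj -> zmodType;
  idm : forall X, hom X X;
  compm : forall X Y Z, hom Y Z -> hom X Y -> hom X Z;
  compmA : forall X Y Z W (h : hom Z W) (g : hom Y Z) (f : hom X Y),
    compm h (compm g f) = compm (compm h g) f;
  comp1m : forall X Y (f : hom X Y), compm (idm Y) f = f;
  compm1 : forall X Y (f : hom X Y), compm f (idm X) = f;
  compmDl : forall X Y Z (g h : hom Y Z) (f : hom X Y),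
    compm (g + h) f = compm g f + compm h f;
  compmDr : forall X Y Z (g : hom Y Z) (f h : hom X Y),
    compm g (f + h) = compm g f + compm g h
}.
Arguments hom {p} X Y.
Arguments idm {p} X.
Arguments compm {p X Y Z} g f.

Notation "g ∘ f" := (compm g f) (at level 40, left associativity) : ring_scope.

Section AbelianCategories.
Variable C : preadditive.
Implicit Types (X Y Z : C).

Definition zero_object X : Prop :=
  (forall Y (f : hom X Y), f = 0) /\ (forall Y (f : hom Y X), f = 0).

Definition mono X Y (f : hom X Y) : Prop :=
  forall W (g h : hom W X), f ∘ g = f ∘ h -> g = h.

Definition epi X Y (f : hom X Y) : Prop :=
  forall W (g h : hom Y W), g ∘ f = h ∘ f -> g = h.

Definition is_kernel X Y (f : hom X Y) K (k : hom K X) : Prop :=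
  f ∘ k = 0 /\
  forall W (g : hom W X), f ∘ g = 0 -> exists! u : hom W K, k ∘ u = g.

Definition is_cokernel X Y (f : hom X Y) Q (q : hom Y Q) : Prop :=
  q ∘ f = 0 /\
  forall W (g : hom Y W), g ∘ f = 0 -> exists! u : hom Q W, u ∘ q = g.

Definition is_biproduct X Y S (i1 : hom X S) (i2 : hom Y S)
    (p1 : hom S X) (p2 : hom S Y) : Prop :=
  [/\ p1 ∘ i1 = idm X, p2 ∘ i2 = idm Y, p1 ∘ i2 = 0, p2 ∘ i1 = 0
    & i1 ∘ p1 + i2 ∘ p2 = idm S].

Definition abelian : Prop :=
  (exists X, zero_object X) /\
  (forall X Y, exists S (i1 : hom X S) (i2 : hom Y S) (p1 : hom S X)
     (p2 : hom S Y), is_biproduct i1 i2 p1 p2) /\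
  (forall X Y (f : hom X Y), exists K (k : hom K X), is_kernel f k) /\
  (forall X Y (f : hom X Y), exists Q (q : hom Y Q), is_cokernel f q) /\
  (forall X Y (f : hom X Y), mono f ->
     exists Z (g : hom Y Z), is_kernel g f) /\
  (forall X Y (f : hom X Y), epi f ->
     exists Z (g : hom Z X), is_cokernel g f).

(* In an abelian category the image of f is the kernel of its cokernel. *)
Definition is_image X Y (f : hom X Y) I (m : hom I Y) : Prop :=
  exists Q (q : hom Y Q), is_cokernel f q /\ is_kernel q m.

(* Im f = Ker g as subobjects of Y; in particular g ∘ f = 0. *)
Definition exact X Y Z (f : hom X Y) (g : hom Y Z) : Prop :=
  exists I (m : hom I Y), is_image f m /\ is_kernel g m.

Definition short_exact X Y Z (f : hom X Y) (g : hom Y Z) : Prop :=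
  [/\ mono f, exact f g & epi g].

Definition projectives : set C := [set P |
  forall X Y (p : hom X Y) (f : hom P Y), epi p ->
    exists g : hom P X, p ∘ g = f].

Definition injectives : set C := [set I |
  forall X Y (i : hom X Y) (f : hom X I), mono i ->
    exists g : hom Y I, g ∘ i = f].

Definition enough_projectives : Prop :=
  forall X, exists P (p : hom P X), projectives P /\ epi p.

Definition enough_injectives : Prop :=
  forall X, exists I (i : hom X I), injectives I /\ mono i.

Definition frobenius : Prop :=
  [/\ abelian, enough_projectives, enough_injectives
    & projectives = injectives].

Record proj_resolution X := ProjResolution {
  pr_obj : nat -> C;
  pr_d : forall n, hom (pr_obj n.+1) (pr_obj n);
  pr_aug : hom (pr_obj 0%N) X;
  pr_projective : forall n, projectives (pr_obj n);
  pr_aug_epi : epi pr_aug;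
  pr_exact_aug : exact (pr_d 0%N) pr_aug;
  pr_exact : forall n, exact (pr_d n.+1) (pr_d n)
}.

Record inj_resolution X := InjResolution {
  ir_obj : nat -> C;
  ir_d : forall n, hom (ir_obj n) (ir_obj n.+1);
  ir_aug : hom X (ir_obj 0%N);
  ir_injective : forall n, injectives (ir_obj n);
  ir_aug_mono : mono ir_aug;
  ir_exact_aug : exact ir_aug (ir_d 0%N);
  ir_exact : forall n, exact (ir_d n) (ir_d n.+1)
}.

(* Zero objects get projective and injective dimension 0. *)
Definition pd_le (n : nat) : set C := [set X |
  exists P : proj_resolution X,
    forall k, (n < k)%N -> zero_object (pr_obj P k)].

Definition id_le (n : nat) : set C := [set X |
  exists I : inj_resolution X,
    forall k, (n < k)%N -> zero_object (ir_obj I k)].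

Definition pd_finite : set C := [set X | exists n, pd_le n X].

Definition id_finite : set C := [set X | exists n, id_le n X].

Definition has_pd X (n : nat) : Prop :=
  pd_le n X /\ forall m, pd_le m X -> (n <= m)%N.

Definition has_id X (n : nat) : Prop :=
  id_le n X /\ forall m, id_le m X -> (n <= m)%N.

(* FPD C is the natural number d (in particular it is finite). *)
Definition FPD_is (d : nat) : Prop :=
  supremums [set n | exists X, pd_finite X /\ has_pd X n] d.

Definition FID_is (d : nat) : Prop :=
  supremums [set n | exists X, id_finite X /\ has_id X n] d.

(* Meant for abelian C with enough projectives and injectives. A uniform bound
   is used since the dimensions in question may a priori be infinite. *)
Definition gorenstein : Prop :=
  (exists n, forall I, injectives I -> pd_le n I) /\
  (exists n, forall P, projectives P -> id_le n P).

(* The i-th cohomology of the complex Hom(P, Y), P a projective resolution,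
   is zero. *)
Definition Hom_cohomology_zero X (P : proj_resolution X) Y (i : nat) : Prop :=
  match i with
  | 0 => forall f : hom (pr_obj P 0) Y, f ∘ pr_d P 0 = 0 -> f = 0
  | j.+1 => forall f : hom (pr_obj P j.+1) Y, f ∘ pr_d P j.+1 = 0 ->
      exists g : hom (pr_obj P j) Y, g ∘ pr_d P j = f
  end.

(* Ext^i(X, Y) = 0, where Ext^i is computed from projective resolutions of X;
   meant for C with enough projectives (otherwise X may have no resolution). *)
Definition Ext_zero (i : nat) X Y : Prop :=
  forall P : proj_resolution X, Hom_cohomology_zero P Y i.

Definition lperp (S : set C) : set C :=
  [set Y | forall X, S X -> Ext_zero 1 Y X].

Definition rperp (S : set C) : set C :=
  [set Y | forall X, S X -> Ext_zero 1 X Y].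

Definition cotorsion_pair (CD : set C * set C) : Prop :=
  CD.1 = lperp CD.2 /\ CD.2 = rperp CD.1.

Definition complete (CD : set C * set C) : Prop :=
  forall X,
    (exists K L (i : hom K L) (p : hom L X),
       [/\ CD.1 L, CD.2 K & short_exact i p]) /\
    (exists K L (i : hom X K) (p : hom K L),
       [/\ CD.1 L, CD.2 K & short_exact i p]).

Definition hereditary (CD : set C * set C) : Prop :=
  forall i X Y, (1 <= i)%N -> CD.1 X -> CD.2 Y -> Ext_zero i X Y.

Record acyclic_complex := AcyclicComplex {
  ac_obj : int -> C;
  ac_d : forall i : int, hom (ac_obj i) (ac_obj (i + 1));
  ac_exact : forall i : int, exact (ac_d i) (ac_d (i + 1))
}.

Definition Hom_acyclic (P : acyclic_complex) Y : Prop :=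
  forall (i : int) (f : hom (ac_obj P (i + 1)) Y), f ∘ ac_d P i = 0 ->
    exists g : hom (ac_obj P (i + 1 + 1)) Y, g ∘ ac_d P (i + 1) = f.

Definition GP : set C := [set X |
  exists P : acyclic_complex,
    [/\ forall i, projectives (ac_obj P i),
        forall Q, projectives Q -> Hom_acyclic P Q
      & exists m : hom X (ac_obj P (-1 + 1)), is_image (ac_d P (-1)) m]].

End AbelianCategories.

Arguments projectives C : clear implicits.
Arguments injectives C : clear implicits.
Arguments enough_projectives C : clear implicits.
Arguments enough_injectives C : clear implicits.
Arguments pd_le C n : clear implicits.
Arguments id_le C n : clear implicits.
Arguments pd_finite C : clear implicits.
Arguments id_finite C : clear implicits.
Arguments FPD_is C d : clear implicits.
Arguments FID_is C d : clear implicits.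
Arguments GP C : clear implicits.

Record functor (C D : preadditive) := Functor {
  fobj :> C -> D;
  fmap : forall X Y : C, hom X Y -> hom (fobj X) (fobj Y);
  fmap1 : forall X : C, fmap (idm X) = idm (fobj X);
  fmapM : forall (X Y Z : C) (g : hom Y Z) (f : hom X Y),
    fmap (g ∘ f) = fmap g ∘ fmap f
}.
Arguments fmap {C D} f {X Y} h : rename.

Record additive_functor (C D : preadditive) := AdditiveFunctor {
  af_functor :> functor C D;
  fmapD : forall (X Y : C) (f g : hom X Y),
    fmap af_functor (f + g) = fmap af_functor f + fmap af_functor g
}.

Definition exact_functor (C D : preadditive) (F : functor C D) : Prop :=
  forall (X Y Z : C) (f : hom X Y) (g : hom Y Z),
    short_exact f g -> short_exact (fmap F f) (fmap F g).

Definition preserves_projectives (C D : preadditive) (F : functor C D) : Prop :=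
  forall P : C, projectives C P -> projectives D (F P).

(* F is left adjoint to G. *)
Definition adjoint (C D : preadditive) (F : functor C D) (G : functor D C) :
    Prop :=
  exists phi : forall (X : C) (Y : D), hom (F X) Y -> hom X (G Y),
    (forall X Y, bijective (phi X Y)) /\
    (forall (X X' : C) (Y Y' : D) (f : hom X' X) (h : hom (F X) Y)
       (g : hom Y Y'),
       phi X' Y' (g ∘ h ∘ fmap F f) = fmap G g ∘ phi X Y h ∘ f).

Section TrivialExtension.
Variables (B : preadditive) (F : additive_functor B B).

Record te_obj := TeObj {
  te_base : B;
  te_str : hom (F te_base) te_base;
  te_strK : te_str ∘ fmap F te_str = 0
}.

Definition te_morph (X Y : te_obj) : {pred hom (te_base X) (te_base Y)} :=
  [pred a | a ∘ te_str X == te_str Y ∘ fmap F a].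
Arguments te_morph : clear implicits.

Lemma comp0m (X Y Z : B) (f : hom X Y) : (0 : hom Y Z) ∘ f = 0.
Proof. by apply: (addIr ((0 : hom Y Z) ∘ f)); rewrite -compmDl !add0r. Qed.

Lemma compm0 (X Y Z : B) (g : hom Y Z) : g ∘ (0 : hom X Y) = 0.
Proof. by apply: (addIr (g ∘ (0 : hom X Y))); rewrite -compmDr !add0r. Qed.

Lemma fmap0 (X Y : B) : fmap F (0 : hom X Y) = 0.
Proof. by apply: (addIr (fmap F (0 : hom X Y))); rewrite -fmapD !add0r. Qed.

Lemma te_morph_zmod_closed (X Y : te_obj) : zmod_closed (te_morph X Y).
Proof.
split=> [|a b]; rewrite !inE; first by rewrite fmap0 comp0m compm0.
move=> /eqP ha /eqP hb; apply/eqP.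
apply: (addIr (b ∘ te_str X)).
by rewrite -compmDl subrK ha hb -compmDr -fmapD subrK.
Qed.

HB.instance Definition _ X Y :=
  GRing.isZmodClosed.Build _ (te_morph X Y) (@te_morph_zmod_closed X Y).

Record te_hom (X Y : te_obj) := TeHom {
  te_val : hom (te_base X) (te_base Y);
  te_valP : te_val \in te_morph X Y
}.

HB.instance Definition _ X Y := [isSub for @te_val X Y].
HB.instance Definition _ X Y := [Choice of te_hom X Y by <:].
HB.instance Definition _ X Y := [SubChoice_isSubZmodule of te_hom X Y by <:].

Lemma te_id_subproof (X : te_obj) : idm (te_base X) \in te_morph X X.
Proof. by rewrite inE comp1m fmap1 compm1. Qed.

Definition te_id (X : te_obj) : te_hom X X := TeHom (te_id_subproof X).

Lemma te_comp_subproof (X Y Z : te_obj) (g : te_hom Y Z) (f : te_hom X Y) :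
  te_val g ∘ te_val f \in te_morph X Z.
Proof.
have /eqP hg := te_valP g; have /eqP hf := te_valP f.
by rewrite inE fmapM -compmA hf !compmA hg.
Qed.

Definition te_comp (X Y Z : te_obj) (g : te_hom Y Z) (f : te_hom X Y) :
  te_hom X Z := TeHom (te_comp_subproof g f).

Fact te_compA (X Y Z W : te_obj) (h : te_hom Z W) (g : te_hom Y Z)
  (f : te_hom X Y) : te_comp h (te_comp g f) = te_comp (te_comp h g) f.
Proof. by apply: val_inj; rewrite /= compmA. Qed.

Fact te_comp1m (X Y : te_obj) (f : te_hom X Y) : te_comp (te_id Y) f = f.
Proof. by apply: val_inj; rewrite /= comp1m. Qed.

Fact te_compm1 (X Y : te_obj) (f : te_hom X Y) : te_comp f (te_id X) = f.
Proof. by apply: val_inj; rewrite /= compm1. Qed.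

Fact te_compDl (X Y Z : te_obj) (g h : te_hom Y Z) (f : te_hom X Y) :
  te_comp (g + h) f = te_comp g f + te_comp h f.
Proof. by apply: val_inj; rewrite /= compmDl. Qed.

Fact te_compDr (X Y Z : te_obj) (g : te_hom Y Z) (f h : te_hom X Y) :
  te_comp g (f + h) = te_comp g f + te_comp g h.
Proof. by apply: val_inj; rewrite /= compmDr. Qed.


Definition trivial_extension : preadditive :=
  @Preadditive te_obj (fun X Y => te_hom X Y : zmodType) te_id te_comp
    te_compA te_comp1m te_compm1 te_compDl te_compDr.

Definition forgetful : functor trivial_extension B :=
  @Functor trivial_extension B te_base (fun X Y (f : te_hom X Y) => te_val f)
    (fun X => erefl) (fun X Y Z g f => erefl).

(* The class Δ(S); here Coker f is in S for some choice of the cokernel. *)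
Definition Delta (S : set B) : set trivial_extension := [set X : te_obj |
  mono (te_str X) /\
  exists Q (q : hom (te_base X) Q), is_cokernel (te_str X) q /\ S Q].

End TrivialExtension.

Definition Uinv (B : preadditive) (F : additive_functor B B) (S : set B) :
    set (trivial_extension F) :=
  forgetful F @^-1` S.

Arguments Delta {B} F S.
Arguments Uinv {B} F S.

(* Main.v *)
(** With A the trivial extension, the forgetful functor U : A -> B has a left
    adjoint T X = X + F X and a right adjoint H J = J + G J, and there are short
    exact sequences 0 -> (F X, 0) -> T X -> X -> 0 and 0 -> X -> H X -> (G X, 0) -> 0
    with (F X, 0) projective when X is, and (G X, 0) injective when X is. So U X
    projective (= injective) gives pd X <= 1 and id X <= 1; conversely U carries finite
    resolutions to finite resolutions over a Frobenius category, which split.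

    For X in Delta(B) and U Y injective, maps extend along every monomorphism with
    cokernel X, because Ext^1(X, Y) is the cokernel of beta |-> beta f_X - f_Y F(beta),
    which is onto. Delta(B) contains the projectives, is closed under subobjects, and
    each of its objects embeds in a projective with cokernel in Delta(B); hence its
    objects are the Gorenstein projectives. *)

From HB Require Import structures.
From mathcomp Require Import all_boot all_order all_algebra.
From mathcomp Require Import boolp classical_sets.
Require Import Defs.

Set Implicit Arguments.
Unset Strict Implicit.
Unset Printing Implicit Defensive.

Import Order.TTheory GRing.Theory.
Local Open Scope classical_set_scope.
Local Open Scope ring_scope.

(** * Preadditive and abelian categories *)

Section Preadditive.
Variable C : preadditive.
Implicit Types X Y Z W : C.

Lemma compNm X Y Z (g : hom Y Z) (f : hom X Y) : (- g) ∘ f = - (g ∘ f).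
Proof. by apply/eqP; rewrite -addr_eq0 -compmDl addNr comp0m. Qed.

Lemma compmN X Y Z (g : hom Y Z) (f : hom X Y) : g ∘ (- f) = - (g ∘ f).
Proof. by apply/eqP; rewrite -addr_eq0 -compmDr addNr compm0. Qed.

Lemma compmBl X Y Z (g h : hom Y Z) (f : hom X Y) : (g - h) ∘ f = g ∘ f - h ∘ f.
Proof. by rewrite compmDl compNm. Qed.

Lemma compmBr X Y Z (g : hom Y Z) (f h : hom X Y) : g ∘ (f - h) = g ∘ f - g ∘ h.
Proof. by rewrite compmDr compmN. Qed.

Lemma mono_eq0 X Y (f : hom X Y) W (g : hom W X) : mono f -> f ∘ g = 0 -> g = 0.
Proof. by move=> fm fg0; apply: fm; rewrite fg0 compm0. Qed.

Lemma epi_eq0 X Y (f : hom X Y) W (g : hom Y W) : epi f -> g ∘ f = 0 -> g = 0.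
Proof. by move=> fe gf0; apply: fe; rewrite gf0 comp0m. Qed.

Lemma mono_of_eq0 X Y (f : hom X Y) :
  (forall W (g : hom W X), f ∘ g = 0 -> g = 0) -> mono f.
Proof.
move=> f0 W g h fgh; apply/eqP; rewrite -subr_eq0; apply/eqP/f0.
by rewrite compmBr fgh subrr.
Qed.

Lemma epi_of_eq0 X Y (f : hom X Y) :
  (forall W (g : hom Y W), g ∘ f = 0 -> g = 0) -> epi f.
Proof.
move=> f0 W g h fgh; apply/eqP; rewrite -subr_eq0; apply/eqP/f0.
by rewrite compmBl fgh subrr.
Qed.

Lemma mono_id X : mono (idm X).
Proof. by move=> W g h; rewrite !comp1m. Qed.

Lemma epi_id X : epi (idm X).
Proof. by move=> W g h; rewrite !compm1. Qed.

Lemma mono_comp X Y Z (g : hom Y Z) (f : hom X Y) : mono g -> mono f -> mono (g ∘ f).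
Proof. by move=> gm fm W a b; rewrite -!compmA => /gm /fm. Qed.

Lemma mono_cancel X Y Z (g : hom Y Z) (f : hom X Y) : mono (g ∘ f) -> mono f.
Proof. by move=> gfm W a b ab; apply: gfm; rewrite -!compmA ab. Qed.

Lemma epi_cancel X Y Z (g : hom Y Z) (f : hom X Y) : epi (g ∘ f) -> epi g.
Proof. by move=> gfe W a b ab; apply: gfe; rewrite !compmA ab. Qed.

Lemma split_mono X Y (s : hom X Y) (r : hom Y X) : r ∘ s = idm X -> mono s.
Proof. by move=> rs; apply: (@mono_cancel _ _ _ r); rewrite rs; apply: mono_id. Qed.

Lemma split_epi X Y (s : hom X Y) (r : hom Y X) : r ∘ s = idm X -> epi r.
Proof. by move=> rs; apply: (@epi_cancel _ _ _ _ s); rewrite rs; apply: epi_id. Qed.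

Section Kernel.
Variables (X Y K : C) (f : hom X Y) (k : hom K X).

Lemma ker_comp : is_kernel f k -> f ∘ k = 0.
Proof. by case. Qed.

Lemma ker_fac W (g : hom W X) : is_kernel f k -> f ∘ g = 0 -> exists u, k ∘ u = g.
Proof. by move=> [_ h] /h [u [? _]]; exists u. Qed.

Lemma ker_mono : is_kernel f k -> mono k.
Proof.
move=> [fk h] W a b ab.
have [|u [_ uu]] := h _ (k ∘ b); first by rewrite compmA fk comp0m.
by rewrite -(uu a ab) -(uu b).
Qed.

Lemma is_kernelI : f ∘ k = 0 -> mono k ->
  (forall W (g : hom W X), f ∘ g = 0 -> exists u, k ∘ u = g) -> is_kernel f k.
Proof.
move=> fk km h; split=> // W g /h [u ku]; exists u; split=> // v kv.
by apply: km; rewrite ku kv.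
Qed.

End Kernel.

Section Cokernel.
Variables (X Y Q : C) (f : hom X Y) (q : hom Y Q).

Lemma coker_comp : is_cokernel f q -> q ∘ f = 0.
Proof. by case. Qed.

Lemma coker_fac W (g : hom Y W) : is_cokernel f q -> g ∘ f = 0 -> exists u, u ∘ q = g.
Proof. by move=> [_ h] /h [u [? _]]; exists u. Qed.

Lemma coker_epi : is_cokernel f q -> epi q.
Proof.
move=> [qf h] W a b ab.
have [|u [_ uu]] := h _ (b ∘ q); first by rewrite -compmA qf compm0.
by rewrite -(uu a ab) -(uu b).
Qed.

Lemma is_cokernelI : q ∘ f = 0 -> epi q ->
  (forall W (g : hom Y W), g ∘ f = 0 -> exists u, u ∘ q = g) -> is_cokernel f q.
Proof.
move=> qf qe h; split=> // W g /h [u uq]; exists u; split=> // v vq.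
by apply: qe; rewrite uq vq.
Qed.

End Cokernel.

(** A kernel-cokernel pair. Over an abelian category this agrees with [short_exact] (see
    [short_exactP]), but it is self-dual and gives both universal properties at once. *)
Definition ses X Y Z (m : hom X Y) (e : hom Y Z) : Prop :=
  is_kernel e m /\ is_cokernel m e.

Lemma ses_mono X Y Z (m : hom X Y) (e : hom Y Z) : ses m e -> mono m.
Proof. by move=> [/ker_mono]. Qed.

Lemma ses_epi X Y Z (m : hom X Y) (e : hom Y Z) : ses m e -> epi e.
Proof. by move=> [_ /coker_epi]. Qed.

(** The endomorphism [idm Y - m ∘ r] kills [m], so it descends along [e]; the descended map is the
    section. *)
Lemma ses_section X Y Z (m : hom X Y) (e : hom Y Z) (r : hom Y X) :
  ses m e -> r ∘ m = idm X -> exists s, e ∘ s = idm Z.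
Proof.
move=> [em me] rm.
have [|s se] := @coker_fac _ _ _ _ _ _ (idm Y - m ∘ r) me.
  by rewrite compmBl comp1m -compmA rm compm1 subrr.
exists s; apply: (coker_epi me).
by rewrite -compmA se compmBr compm1 compmA (ker_comp em) comp0m subr0 comp1m.
Qed.

Lemma ses_retraction X Y Z (m : hom X Y) (e : hom Y Z) (s : hom Z Y) :
  ses m e -> e ∘ s = idm Z -> exists r, r ∘ m = idm X.
Proof.
move=> [em me] es.
have [|r mr] := @ker_fac _ _ _ _ _ _ (idm Y - s ∘ e) em.
  by rewrite compmBr compm1 compmA es comp1m subrr.
exists r; apply: (ker_mono em).
by rewrite compmA mr compmBl comp1m -compmA (ker_comp em) compm0 subr0 compm1.
Qed.

Lemma zero_id X : idm X = 0 -> zero_object X.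
Proof.
by move=> X0; split=> Y f; rewrite -1?(compm1 f) -1?(comp1m f) X0 ?compm0 ?comp0m.
Qed.

Lemma zero_hom0 X Y (f : hom X Y) : zero_object X -> f = 0.
Proof. by case. Qed.

Lemma hom_zero0 X Y (f : hom X Y) : zero_object Y -> f = 0.
Proof. by case. Qed.

(** Supplies the end of a finite resolution: the last nonzero term and the zero tail after it. *)
Lemma ses_zero_id Z X : zero_object Z -> ses (0 : hom Z X) (idm X).
Proof.
move=> z; split.
  apply: is_kernelI; [exact: compm0| |].
    by move=> W g h _; rewrite (hom_zero0 g z) (hom_zero0 h z).
  by move=> W g; rewrite comp1m => ->; exists 0; rewrite compm0.
apply: is_cokernelI; [exact: compm0|exact: epi_id|].
by move=> W g _; exists g; rewrite compm1.
Qed.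

Section Biproduct.
Variables (X Y S : C) (i1 : hom X S) (i2 : hom Y S) (p1 : hom S X) (p2 : hom S Y).
Hypothesis hS : is_biproduct i1 i2 p1 p2.

Lemma bip_in W (f g : hom S W) : f ∘ i1 = g ∘ i1 -> f ∘ i2 = g ∘ i2 -> f = g.
Proof.
case: hS => _ _ _ _ h h1 h2; rewrite -(compm1 f) -(compm1 g) -h !compmDr !compmA.
by rewrite h1 h2.
Qed.

Lemma bip_out W (f g : hom W S) : p1 ∘ f = p1 ∘ g -> p2 ∘ f = p2 ∘ g -> f = g.
Proof.
case: hS => _ _ _ _ h h1 h2; rewrite -(comp1m f) -(comp1m g) -h !compmDl -!compmA.
by rewrite h1 h2.
Qed.

Lemma bip11 : p1 ∘ i1 = idm X. Proof. by case: hS. Qed.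
Lemma bip22 : p2 ∘ i2 = idm Y. Proof. by case: hS. Qed.
Lemma bip12 : p1 ∘ i2 = 0. Proof. by case: hS. Qed.
Lemma bip21 : p2 ∘ i1 = 0. Proof. by case: hS. Qed.

Lemma ses_bip : ses i2 p1.
Proof.
have [_ _ _ _ h] := hS; split.
  apply: is_kernelI; [exact: bip12|exact: split_mono bip22|].
  move=> W g pg; exists (p2 ∘ g); apply: bip_out.
    by rewrite !compmA bip12 !comp0m pg.
  by rewrite !compmA bip22 comp1m.
apply: is_cokernelI; [exact: bip12|exact: split_epi bip11|].
move=> W g gi; exists (g ∘ i1); apply: bip_in.
  by rewrite -!compmA bip11 compm1.
by rewrite -!compmA bip12 !compm0 gi.
Qed.

End Biproduct.

Lemma projective_retract X P (s : hom X P) (r : hom P X) :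
  r ∘ s = idm X -> projectives C P -> projectives C X.
Proof.
move=> rs pP Y Z p f /(pP _ _ p (f ∘ r)) [g pg]; exists (g ∘ s).
by rewrite compmA pg -compmA rs compm1.
Qed.

Lemma projective_zero X : zero_object X -> projectives C X.
Proof. by move=> z Y Z p f _; exists 0; rewrite compm0 (zero_hom0 f z). Qed.

Lemma projective_biproduct X Y S (i1 : hom X S) (i2 : hom Y S) (p1 : hom S X)
    (p2 : hom S Y) : is_biproduct i1 i2 p1 p2 ->
  projectives C X -> projectives C Y -> projectives C S.
Proof.
move=> hS pX pY V W p f pe.
have [g1 h1] := pX _ _ p (f ∘ i1) pe; have [g2 h2] := pY _ _ p (f ∘ i2) pe.
exists (g1 ∘ p1 + g2 ∘ p2); apply: (bip_in hS).
  by rewrite compmDr compmDl !compmA h1 h2 -!compmA (bip11 hS) (bip21 hS) compm1 !compm0 addr0.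
by rewrite compmDr compmDl !compmA h1 h2 -!compmA (bip22 hS) (bip12 hS) compm1 !compm0 add0r.
Qed.

Lemma projective_section X P (e : hom X P) :
  projectives C P -> epi e -> exists s, e ∘ s = idm P.
Proof. by move=> pP /(pP _ _ e (idm P)). Qed.

End Preadditive.

(** * Images and exactness in an abelian category *)

Section Abelian.
Variable C : preadditive.
Hypothesis abC : abelian C.
Implicit Types X Y Z W : C.

Lemma zero_exists : exists Z : C, zero_object Z.
Proof. by case: abC. Qed.

Lemma biproduct_exists X Y : exists S (i1 : hom X S) (i2 : hom Y S) (p1 : hom S X)
     (p2 : hom S Y), is_biproduct i1 i2 p1 p2.
Proof. by case: abC => _ []. Qed.

Lemma kernel_exists X Y (f : hom X Y) : exists K (k : hom K X), is_kernel f k.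
Proof. by case: abC => _ [_ []]. Qed.

Lemma cokernel_exists X Y (f : hom X Y) : exists Q (q : hom Y Q), is_cokernel f q.
Proof. by case: abC => _ [_ [_ []]]. Qed.

Lemma mono_kernel X Y Q (f : hom X Y) (q : hom Y Q) :
  mono f -> is_cokernel f q -> is_kernel q f.
Proof.
move=> fm qc; case: (abC) => _ [_ [_ [_ [h _]]]]; have [Z [g gk]] := h _ _ _ fm.
apply: is_kernelI => //; first exact: coker_comp qc.
move=> W a qa; have [s sg] := coker_fac qc (ker_comp gk).
by apply: (ker_fac gk); rewrite -sg -compmA qa compm0.
Qed.

Lemma epi_cokernel X Y K (f : hom X Y) (k : hom K X) :
  epi f -> is_kernel f k -> is_cokernel k f.
Proof.
move=> fm qc; case: (abC) => _ [_ [_ [_ [_ h]]]]; have [Z [g gk]] := h _ _ _ fm.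
apply: is_cokernelI => //; first exact: ker_comp qc.
move=> W a qa; have [s sg] := ker_fac qc (coker_comp gk).
by apply: (coker_fac gk); rewrite -sg compmA qa comp0m.
Qed.

Lemma mono_ses X Y (f : hom X Y) : mono f -> exists Q (q : hom Y Q), ses f q.
Proof.
by move=> fm; have [Q [q hq]] := cokernel_exists f; exists Q, q; split=> //; apply: mono_kernel.
Qed.

Lemma epi_ses X Y (f : hom X Y) : epi f -> exists K (k : hom K X), ses k f.
Proof.
by move=> fm; have [Q [q hq]] := kernel_exists f; exists Q, q; split=> //; apply: epi_cokernel.
Qed.

(** If [h ∘ e = 0], then [e] factors through the kernel [k] of [h]. The cokernel [r] of the
    monomorphism [m ∘ k] kills [f], hence factors through [q] and kills [m]. So [m] factors through
    [m ∘ k], which splits [k] and forces [h = 0]. *)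
Lemma coimage_epi X Y Q I (f : hom X Y) (q : hom Y Q) (m : hom I Y) (e : hom X I) :
  is_cokernel f q -> is_kernel q m -> f = m ∘ e -> epi e.
Proof.
move=> fq qm fE; apply: epi_of_eq0 => W h he.
have [K [k hk]] := kernel_exists h.
have [e' ke] := ker_fac hk he.
have mk : mono (m ∘ k) by apply: mono_comp; [exact: ker_mono qm|exact: ker_mono hk].
have [R [r mkr]] := mono_ses mk.
have rf : r ∘ f = 0.
  by rewrite fE -ke (compmA m) compmA (ker_comp mkr.1) comp0m.
have [s sq] := coker_fac fq rf.
have [|v mkv] := @ker_fac _ _ _ _ _ _ _ m mkr.1.
  by rewrite -sq -compmA (ker_comp qm) compm0.
have kv : k ∘ v = idm I.
  by apply: (ker_mono qm); rewrite compmA mkv compm1.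
by rewrite -(compm1 h) -kv compmA (ker_comp hk) comp0m.
Qed.

Lemma image_fac X Y (f : hom X Y) :
  exists I (m : hom I Y) (e : hom X I), [/\ f = m ∘ e, mono m & epi e].
Proof.
have [Q [q fq]] := cokernel_exists f; have [I [m qm]] := kernel_exists q.
have [e me] := ker_fac qm (coker_comp fq).
by exists I, m, e; split=> //; [exact: ker_mono qm|exact: coimage_epi fq qm _].
Qed.

Lemma cokernel_epi_comp X Y Z Q (m : hom Y Z) (e : hom X Y) (q : hom Z Q) :
  epi e -> is_cokernel (m ∘ e) q <-> is_cokernel m q.
Proof.
move=> ee; split=> h; have qe := coker_epi h; apply: is_cokernelI => //.
- by apply: (epi_eq0 ee); rewrite -compmA (coker_comp h).
- by move=> W g gm; apply: (coker_fac h); rewrite compmA gm comp0m.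
- by rewrite compmA (coker_comp h) comp0m.
- by move=> W g gm; apply: (coker_fac h); apply: (epi_eq0 ee); rewrite -compmA.
Qed.

Lemma kernel_mono_comp X Y Z K (m : hom Y Z) (e : hom X Y) (k : hom K X) :
  mono m -> is_kernel (m ∘ e) k <-> is_kernel e k.
Proof.
move=> ee; split=> h; have qe := ker_mono h; apply: is_kernelI => //.
- by apply: (mono_eq0 ee); rewrite compmA (ker_comp h).
- by move=> W g gm; apply: (ker_fac h); rewrite -compmA gm compm0.
- by rewrite -compmA (ker_comp h) compm0.
- by move=> W g gm; apply: (ker_fac h); apply: (mono_eq0 ee); rewrite compmA.
Qed.

Lemma is_imageI X Y I (m : hom I Y) (e : hom X I) :
  mono m -> epi e -> is_image (m ∘ e) m.
Proof.
move=> mm ee; have [Q [q [hk hc]]] := mono_ses mm; exists Q, q; split=> //.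
exact/(cokernel_epi_comp _ _ ee).
Qed.

Lemma exactP X Y Z (f : hom X Y) (g : hom Y Z) : exact f g <->
  exists I (m : hom I Y) (e : hom X I), [/\ f = m ∘ e, epi e & is_kernel g m].
Proof.
split=> [[I [m [[Q [q [fq qm]]] gm]]]|[I [m [e [-> ee gm]]]]].
  have [e me] := ker_fac qm (coker_comp fq).
  by exists I, m, e; split=> //; exact: coimage_epi fq qm _.
by exists I, m; split=> //; apply: is_imageI => //; exact: ker_mono gm.
Qed.

Lemma short_exactP X Y Z (f : hom X Y) (g : hom Y Z) : short_exact f g <-> ses f g.
Proof.
split=> [[fm /exactP[I [m [e [fE ee gm]]]] ge]|[gf fg]].
  have fg : is_cokernel f g.
    by rewrite fE; apply/(cokernel_epi_comp _ _ ee); exact: epi_cokernel.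
  by split=> //; exact: mono_kernel.
split; [exact: ker_mono gf| |exact: coker_epi fg].
by apply/exactP; exists X, f, (idm X); split; rewrite ?compm1 //; exact: epi_id.
Qed.

(** The mirror image of [exactP]: the definition of [exact] favours kernels, and duality needs the
    form that favours cokernels. *)
Lemma exact_coP X Y Z (f : hom X Y) (g : hom Y Z) : exact f g <->
  exists I (m : hom I Z) (e : hom Y I), [/\ g = m ∘ e, mono m & is_cokernel f e].
Proof.
split.
  case/exactP=> K [k [c [-> ce gk]]]; have [I [m [e [gE mm ee]]]] := image_fac g.
  exists I, m, e; split=> //; apply/(cokernel_epi_comp _ _ ce).
  by apply: epi_cokernel => //; apply/(kernel_mono_comp _ _ mm); rewrite -gE.
case=> I [m [e [-> mm fe]]]; apply/exactP.
have [K [k [ek ke]]] := epi_ses (coker_epi fe).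
have [c kc] := ker_fac ek (coker_comp fe).
exists K, k, c; split=> //; last exact/(kernel_mono_comp _ _ mm).
exact: coimage_epi fe ek _.
Qed.

End Abelian.

(** * The opposite category and duality *)

Definition opp (C : preadditive) : preadditive :=
  @Preadditive C (fun X Y : C => hom Y X) (fun X : C => idm X)
    (fun X Y Z (g : hom Z Y) (f : hom Y X) => f ∘ g)
    (fun X Y Z W h g f => esym (compmA f g h))
    (fun X Y f => compm1 f) (fun X Y f => comp1m f)
    (fun X Y Z g h f => compmDr f g h) (fun X Y Z g f h => compmDl f h g).

Section Opposite.
Variable C : preadditive.

Lemma abelian_opp : abelian C -> abelian (opp C).
Proof.
move=> [[Z [z1 z2]] [bp [kr [ck [mk ec]]]]]; split; [|split; [|split; [|split; [|split]]]].
- by exists Z; split.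
- move=> X Y; have [S [i1 [i2 [p1 [p2 [h1 h2 h3 h4 h5]]]]]] := bp X Y.
  by exists S, p1, p2, i1, i2; split.
- by move=> X Y f; have [Q [q h]] := ck _ _ f; exists Q, q.
- by move=> X Y f; have [Q [q h]] := kr _ _ f; exists Q, q.
- by move=> X Y f /(ec Y X f) [W [g h]]; exists W, g.
- by move=> X Y f /(mk Y X f) [W [g h]]; exists W, g.
Qed.

(** Monomorphisms of [C] are by conversion epimorphisms of [opp C], so dual statements follow by
    feeding the data in reversed order. *)
Lemma injectives_opp : injectives C = projectives (opp C).
Proof.
apply/seteqP; split=> I h X Y i f fm; first exact: (h Y X i f).
exact: (h Y X i f).
Qed.

Lemma projectives_opp : projectives C = injectives (opp C).
Proof.
apply/seteqP; split=> I h X Y i f fm; first exact: (h Y X i f).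
exact: (h Y X i f).
Qed.

Lemma exact_opp (abC : abelian C) (X Y Z : C) (f : hom X Y) (g : hom Y Z) :
  exact f g <-> @exact (opp C) Z Y X g f.
Proof.
split.
  case/(exact_coP abC)=> I [m [e [gE mm ee]]].
  by apply/(exactP (abelian_opp abC)); exists I, e, m.
case/(exactP (abelian_opp abC))=> I [e [m [gE mm ee]]].
by apply/(exact_coP abC); exists I, m, e.
Qed.

(** Reduces injective dimension to projective dimension, so that resolutions need to be studied on
    one side only. *)
Lemma id_le_opp (abC : abelian C) n : id_le C n = pd_le (opp C) n.
Proof.
apply/seteqP; split=> X.
  case=> [[I d a ii am ea ex]] /= z.
  unshelve eexists (@ProjResolution (opp C) X I d a _ am _ _).
  - by move=> k; rewrite -injectives_opp.
  - exact/(exact_opp abC).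
  - by move=> k; apply/(exact_opp abC).
  - by move=> k /z [z1 z2]; split.
case=> [[I d a ii am ea ex]] /= z.
unshelve eexists (@InjResolution C X I d a _ am _ _).
- by move=> k; rewrite injectives_opp.
- exact/(exact_opp abC).
- by move=> k; apply/(exact_opp abC).
- by move=> k /z [z1 z2]; split.
Qed.

Lemma injective_retract (X I : C) (s : hom X I) (r : hom I X) :
  r ∘ s = idm X -> injectives C I -> injectives C X.
Proof. by rewrite injectives_opp; exact: (@projective_retract (opp C) X I r s). Qed.

Lemma injective_biproduct (X Y S : C) (i1 : hom X S) (i2 : hom Y S) (p1 : hom S X)
    (p2 : hom S Y) : is_biproduct i1 i2 p1 p2 ->
  injectives C X -> injectives C Y -> injectives C S.
Proof.
rewrite injectives_opp => -[h1 h2 h3 h4 h5].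
exact: (@projective_biproduct (opp C) X Y S p1 p2 i1 i2).
Qed.

Lemma injective_retraction (I Y : C) (m : hom I Y) :
  injectives C I -> mono m -> exists r, r ∘ m = idm I.
Proof. by move=> iI /(iI _ _ m (idm I)). Qed.

End Opposite.
(** * Resolutions and Ext *)

Section Resolutions.
Variable C : preadditive.
Hypothesis abC : abelian C.
Implicit Types X Y : C.

(** Cuts a resolution into short exact sequences with one coherent choice of syzygies, the form in
    which all dimension arguments use it. *)
Lemma resolution_syzygies X (R : proj_resolution X) :
  exists (Z : nat -> C) (m : forall n, hom (Z n) (pr_obj R n))
      (e : forall n, hom (pr_obj R n.+1) (Z n)),
    [/\ ses (m 0%N) (pr_aug R), forall n, ses (m n.+1) (e n)
      & forall n, pr_d R n = m n ∘ e n].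
Proof.
(* The map out of [pr_obj R n] is the augmentation for [n = 0] and a differential otherwise; [K]
   treats both cases uniformly. *)
pose K n I : hom I (pr_obj R n) -> Prop :=
  match n return hom I (pr_obj R n) -> Prop with
  | 0 => fun m => is_kernel (pr_aug R) m
  | k.+1 => fun m => is_kernel (pr_d R k) m
  end.
have H n : exists t : {I : C & (hom I (pr_obj R n) * hom (pr_obj R n.+1) I)%type},
    [/\ pr_d R n = (projT2 t).1 ∘ (projT2 t).2, epi (projT2 t).2
      & K n (projT1 t) (projT2 t).1].
  have [I [m [e h]]] : exists I (m : hom I (pr_obj R n)) (e : hom (pr_obj R n.+1) I),
      [/\ pr_d R n = m ∘ e, epi e & K n I m].
    case: n @K => [|n] K; first exact/(exactP abC)/pr_exact_aug.
    exact/(exactP abC)/pr_exact.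
  by exists (existT _ I (m, e)).
pose t n := projT1 (cid (H n)).
have tP n : [/\ pr_d R n = (projT2 (t n)).1 ∘ (projT2 (t n)).2, epi (projT2 (t n)).2
      & K n (projT1 (t n)) (projT2 (t n)).1] := projT2 (cid (H n)).
exists (fun n => projT1 (t n)), (fun n => (projT2 (t n)).1), (fun n => (projT2 (t n)).2).
have mm n : mono (projT2 (t n)).1.
  by have [_ _] := tP n; case: n => [|n] /ker_mono.
split=> [|n|n]; last by case: (tP n).
  have [_ _ k0] := tP 0%N; split=> //.
  exact: epi_cokernel (@pr_aug_epi _ _ R) k0.
have [dE ee _] := tP n; have [_ _ kn] := tP n.+1.
have ken : is_kernel (projT2 (t n)).2 (projT2 (t n.+1)).1.
  by apply/(kernel_mono_comp _ _ (mm n)); rewrite -dE.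
by split=> //; apply: epi_cokernel.
Qed.

(** When projectives are injective, a sequence with projective kernel splits, so projectivity passes
    from each syzygy to the one before it and finally to [X]. *)
Lemma pd_le_projective n X : projectives C = injectives C ->
  pd_le C n X -> projectives C X.
Proof.
move=> PI [R z]; have [Z [m [e [h0 hs _]]]] := resolution_syzygies R.
have step (A P D : C) (a : hom A P) (b : hom P D) : ses a b ->
    projectives C P -> projectives C A -> projectives C D.
  move=> ab pP; rewrite {1}PI => iA.
  have [r ra] := injective_retraction iA (ses_mono ab).
  have [s bs] := ses_section ab ra; exact: projective_retract bs pP.
(* Descending induction from [Z n], which is zero as a quotient of [pr_obj R n.+1]. *)
suff pZ k : (k <= n)%N -> projectives C (Z (n - k)%N).
  apply: (step _ _ _ _ _ h0); first exact: pr_projective.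
  by have := pZ n (leqnn n); rewrite subnn.
elim: k => [|k IH] kn.
  rewrite subn0; apply: projective_zero; apply: zero_id.
  apply: (epi_eq0 (ses_epi (hs n))); rewrite comp1m.
  by apply: zero_hom0; apply: z.
have := IH (ltnW kn); rewrite -(subnSK kn); apply: step _ _ _ _ _ (hs _) _.
exact: pr_projective.
Qed.

(* Dimension shifting in one step: the cokernels met along the resolution all lie in S. *)
Lemma Ext_zero_of_extension (S : set C) X Y i :
  (forall A P D (m : hom A P) (e : hom P D), ses m e -> S D ->
     forall a : hom A Y, exists b, b ∘ m = a) ->
  (forall A P (m : hom A P), mono m -> projectives C P -> S A) ->
  S X -> (1 <= i)%N -> Ext_zero i X Y.
Proof.
case: i => // i hext hsub SX _ R /= f fd.
have [Z [m [e [h0 hs dE]]]] := resolution_syzygies R.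
have SZ k : S (Z k).
  case: k => [|k]; first exact: hsub _ _ _ (ses_mono h0) (@pr_projective _ _ R _).
  exact: hsub _ _ _ (ses_mono (hs _)) (@pr_projective _ _ R _).
have fm : f ∘ m i.+1 = 0.
  by apply: (epi_eq0 (ses_epi (hs i.+1))); rewrite -compmA -dE.
have [f' f'e] := coker_fac (hs i).2 fm.
suff [g gm] : exists g, g ∘ m i = f' by exists g; rewrite dE compmA gm.
(* The cokernel of [m i] is [X] for [i = 0] and the preceding syzygy otherwise; both lie in [S]. *)
case: i f fd fm f' f'e => [|i] f fd fm f' f'e; first exact: hext _ _ _ _ _ h0 SX f'.
exact: hext _ _ _ _ _ (hs i) (SZ i) f'.
Qed.

(** * Resolutions spliced from short exact sequences *)

Section FromSyzygies.
Variables (Z P : nat -> C) (m : forall n, hom (Z n.+1) (P n)) (e : forall n, hom (P n) (Z n)).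
Hypothesis (hs : forall n, ses (m n) (e n)) (hP : forall n, projectives C (P n)).

Lemma exact_splice X Y A D W (a : hom A Y) (b : hom X A) (c : hom Y D) (d : hom D W) :
  ses a c -> epi b -> mono d -> exact (a ∘ b) (d ∘ c).
Proof.
move=> [ca ac] be dm; apply/(exactP abC); exists A, a, b; split=> //.
exact/(kernel_mono_comp _ _ dm).
Qed.

Fact aug_exact : exact (m 0%N ∘ e 1%N) (e 0%N).
Proof.
rewrite -(comp1m (e 0%N)).
exact: exact_splice (hs 0) (ses_epi (hs 1)) (@mono_id _ _).
Qed.

Fact diff_exact n : exact (m n.+1 ∘ e n.+2) (m n ∘ e n.+1).
Proof. exact: exact_splice (hs _) (ses_epi (hs _)) (ses_mono (hs _)). Qed.

Definition resolution_of_syzygies : proj_resolution (Z 0%N) :=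
  ProjResolution hP (ses_epi (hs 0)) aug_exact diff_exact.

End FromSyzygies.

Lemma pd_le0P X : pd_le C 0 X <-> projectives C X.
Proof.
split=> [[R z]|pX].
  have [Z [m [e [h0 hs _]]]] := resolution_syzygies R.
  have Z0 : zero_object (Z 0%N).
    apply: zero_id; apply: (epi_eq0 (ses_epi (hs 0%N))); rewrite comp1m.
    by apply: zero_hom0; apply: z.
  (* As [Z 0] is zero, the zero map retracts [m 0], and the augmentation splits. *)
  have [|r rm] := @ses_section _ _ _ _ _ _ 0 h0; first by rewrite comp0m [RHS]zero_hom0.
  exact: projective_retract rm (@pr_projective _ _ R 0).
have [O zO] := zero_exists abC.
pose Z n := if n is 0 then X else O.
have hs n : ses (0 : hom (Z n.+1) (Z n)) (idm (Z n)) by apply: ses_zero_id.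
have hp n : projectives C (Z n) by case: n => [|n] //=; apply: projective_zero.
by exists (resolution_of_syzygies hs hp) => -[|k].
Qed.

Lemma pd_le1I A P X (m : hom A P) (e : hom P X) :
  ses m e -> projectives C A -> projectives C P -> pd_le C 1 X.
Proof.
move=> me pA pP; have [O zO] := zero_exists abC.
pose Z n := match n with 0 => X | 1 => A | _ => O end.
pose Q n := match n with 0 => P | 1 => A | _ => O end.
pose mm n : hom (Z n.+1) (Q n) :=
  match n return hom (Z n.+1) (Q n) with 0 => m | _ => 0 end.
pose ee n : hom (Q n) (Z n) :=
  match n return hom (Q n) (Z n) with 0 => e | 1 => idm A | _ => idm O end.
have hs n : ses (mm n) (ee n) by case: n => [|[|n]] //=; apply: ses_zero_id.
have hp n : projectives C (Q n) by case: n => [|[|n]] //=; apply: projective_zero.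
by exists (resolution_of_syzygies hs hp) => -[|[|k]].
Qed.

(** [Ext_zero] speaks of every resolution of [X], so it may be applied to one that begins with the
    given [P]. There [a ∘ ee 1] is a cocycle, and a map bounding it extends [a] once the epimorphism
    [ee 1] is cancelled. *)
Lemma Ext_zero1_extension X Y A P (m : hom A P) (e : hom P X) :
  enough_projectives C -> ses m e -> projectives C P -> Ext_zero 1 X Y ->
  forall a : hom A Y, exists b, b ∘ m = a.
Proof.
move=> ep me pP hE a.
have H X' : exists t : {K : C & {Q : C & (hom K Q * hom Q X')%type}},
    projectives C (projT1 (projT2 t)) /\ ses (projT2 (projT2 t)).1 (projT2 (projT2 t)).2.
  have [Q [q [pQ qe]]] := ep X'; have [K [k kq]] := epi_ses abC qe.
  by exists (existT _ K (existT _ Q (k, q))).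
pose t X' := projT1 (cid (H X')); have tP X' := projT2 (cid (H X')) : 
  projectives C (projT1 (projT2 (t X'))) /\
  ses (projT2 (projT2 (t X'))).1 (projT2 (projT2 (t X'))).2.
(* The iterated syzygies of [A] for the chosen projective presentations; the resolution of [X] is
   [P] followed by these presentations. *)
pose W n := iter n (fun X' => projT1 (t X')) A.
pose Z n := if n is n'.+1 then W n' else X.
pose Q n := if n is n'.+1 then projT1 (projT2 (t (W n'))) else P.
pose mm n : hom (Z n.+1) (Q n) :=
  match n return hom (Z n.+1) (Q n) with
  | 0 => m | n'.+1 => (projT2 (projT2 (t (W n')))).1 end.
pose ee n : hom (Q n) (Z n) :=
  match n return hom (Q n) (Z n) with
  | 0 => e | n'.+1 => (projT2 (projT2 (t (W n')))).2 end.
have hs n : ses (mm n) (ee n) by case: n => [|n] //=; apply: (tP _).2.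
have hp n : projectives C (Q n) by case: n => [|n] //=; apply: (tP _).1.
have [|b /= bE] := hE (resolution_of_syzygies hs hp) (a ∘ ee 1%N).
  by rewrite /= compmA -(compmA a) (ker_comp (hs 1%N).1) compm0 comp0m.
exists b; apply: (ses_epi (hs 1%N)).
by rewrite -compmA.
Qed.

End Resolutions.
(** * The trivial extension *)

Section TrivialExtension.
Variables (B : preadditive) (F : additive_functor B B).
Hypothesis frobB : frobenius B.
Hypothesis exactF : exact_functor F.
Hypothesis F2_0 : forall X : B, zero_object (F (F X)).
Hypothesis projF : preserves_projectives F.

Variables (G : B -> B) (phi : forall X Y : B, hom (F X) Y -> hom X (G Y)).
Hypothesis phi_bij : forall X Y, bijective (@phi X Y).
Hypothesis phi_comp : forall (X X' Y : B) (h : hom (F X) Y) (f : hom X' X),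
  phi (h ∘ fmap F f) = phi h ∘ f.

Let abB : abelian B. Proof. by case: frobB. Qed.
Let epB : enough_projectives B. Proof. by case: frobB. Qed.
Let eiB : enough_injectives B. Proof. by case: frobB. Qed.
Let projinj : projectives B = injectives B. Proof. by case: frobB. Qed.

Local Notation A := (trivial_extension F).

(** * Consequences of the adjunction and of F^2 = 0 *)

Lemma phi_inj X Y : injective (@phi X Y).
Proof. exact: bij_inj. Qed.

Lemma phi_surj X Y (k : hom X (G Y)) : exists h, phi h = k.
Proof. by have [psi _ K] := phi_bij X Y; exists (psi k). Qed.

Lemma phi0 X Y : phi (0 : hom (F X) Y) = 0.
Proof. by rewrite -(comp0m Y (fmap F (0 : hom X X))) phi_comp compm0. Qed.

Lemma FF_eq (X Y : B) (f g : hom (F (F X)) Y) : f = g.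
Proof. by rewrite (zero_hom0 f (F2_0 X)) (zero_hom0 g (F2_0 X)). Qed.

(** Such a map is the transpose of a map out of [F (F X)], which is zero. *)
Lemma hom_F_G_eq0 (X Y : B) (f : hom (F X) (G Y)) : f = 0.
Proof.
by have [h <-] := phi_surj f; rewrite -(phi0 (F X) Y); congr phi; apply: FF_eq.
Qed.

Lemma epi_F (X Y : B) (f : hom X Y) : epi f -> epi (fmap F f).
Proof. by move=> fe W g h gh; apply: phi_inj; apply: fe; rewrite -!phi_comp gh. Qed.

(** A left adjoint preserves cokernels: transposing turns the universal property for [fmap F f] into
    the one for [f]. *)
Lemma cokernel_F (X Y Q : B) (f : hom X Y) (q : hom Y Q) :
  is_cokernel f q -> is_cokernel (fmap F f) (fmap F q).
Proof.
move=> fq; apply: is_cokernelI.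
- by rewrite -fmapM (coker_comp fq) fmap0.
- exact: epi_F (coker_epi fq).
- move=> W g gf; have [|u uq] := @coker_fac _ _ _ _ _ _ _ (phi g) fq.
    by rewrite -phi_comp gf phi0.
  have [v vE] := phi_surj u; exists v; apply: phi_inj.
  by rewrite phi_comp vE.
Qed.

Lemma mono_F (X Y : B) (f : hom X Y) : mono f -> mono (fmap F f).
Proof. by move=> /(mono_ses abB)[Q [q /(short_exactP abB)/exactF[]]]. Qed.

Lemma ses_F (X Y Z : B) (f : hom X Y) (g : hom Y Z) :
  ses f g -> ses (fmap F f) (fmap F g).
Proof. by move/(short_exactP abB)/exactF/(short_exactP abB). Qed.

Lemma injective_F J : injectives B J -> injectives B (F J).
Proof. by rewrite -projinj; apply: projF. Qed.

(** A right adjoint of a functor preserving monomorphisms preserves injectives. *)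
Lemma injective_G J : injectives B J -> injectives B (G J).
Proof.
move=> iJ X Y i f im; have [h hE] := phi_surj f.
have [g gE] := iJ _ _ _ h (mono_F im); exists (phi g).
by rewrite -phi_comp gE.
Qed.

(** The condition on the structure map is an equation between maps out of [F (F X)], so every [f] is
    admissible. *)
Definition te_make (X : B) (f : hom (F X) X) : A := @TeObj B F X f (FF_eq _ _).

Lemma te_sq (X Y : A) (a : hom X Y) :
  te_val a ∘ te_str X = te_str Y ∘ fmap F (te_val a).
Proof. exact/eqP/(te_valP a). Qed.

Lemma te_lift (X Y : A) (b : hom (te_base X) (te_base Y)) :
  b ∘ te_str X = te_str Y ∘ fmap F b -> exists a : hom X Y, te_val a = b.
Proof.
move=> h; have hb : b \in @te_morph B F X Y by rewrite inE h.
by exists (TeHom hb).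
Qed.

Lemma te_eq (X Y : A) (a b : hom X Y) : te_val a = te_val b -> a = b.
Proof. exact: val_inj. Qed.

(** * Exactness in the trivial extension is computed in [B] *)

Lemma te_valM (X Y Z : A) (g : hom Y Z) (f : hom X Y) :
  te_val (g ∘ f) = te_val g ∘ te_val f.
Proof. by []. Qed.

Lemma mono_reflect (X Y : A) (a : hom X Y) : mono (te_val a) -> mono a.
Proof. by move=> m W g h /(congr1 (@te_val _ _ _ _))/m/te_eq. Qed.

Lemma epi_reflect (X Y : A) (a : hom X Y) : epi (te_val a) -> epi a.
Proof. by move=> m W g h /(congr1 (@te_val _ _ _ _))/m/te_eq. Qed.

Lemma kernel_reflect (X Y K : A) (a : hom X Y) (k : hom K X) :
  is_kernel (te_val a) (te_val k) -> is_kernel a k.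
Proof.
move=> ak; apply: is_kernelI.
- by apply: te_eq; exact: ker_comp ak.
- exact: mono_reflect (ker_mono ak).
- move=> W g /(congr1 (@te_val _ _ _ _)) ag; have [u ku] := ker_fac ak ag.
  have [|v vu] := @te_lift W K u; last by exists v; apply: te_eq; rewrite te_valM vu.
  apply: (ker_mono ak).
  by rewrite !compmA ku te_sq -ku fmapM compmA te_sq.
Qed.

Lemma cokernel_reflect (X Y K : A) (a : hom X Y) (k : hom Y K) :
  is_cokernel (te_val a) (te_val k) -> is_cokernel a k.
Proof.
move=> ak; apply: is_cokernelI.
- by apply: te_eq; exact: coker_comp ak.
- exact: epi_reflect (coker_epi ak).
- move=> W g /(congr1 (@te_val _ _ _ _)) ag; have [u ku] := coker_fac ak ag.
  have [|v vu] := @te_lift K W u; last by exists v; apply: te_eq; rewrite te_valM vu.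
  (* Compatibility of the induced map with the structure maps is checked after precomposing with the
     epimorphism [F(k)]. *)
  apply: (epi_F (coker_epi ak)).
  by rewrite -!compmA -te_sq -fmapM ku compmA ku te_sq.
Qed.

Lemma kernel_lift (X Y : A) (a : hom X Y) :
  exists (K : A) (k : hom K X), is_kernel (te_val a) (te_val k).
Proof.
have [K [k ak]] := kernel_exists abB (te_val a).
have [|f fE] := @ker_fac _ _ _ _ _ _ _ (te_str X ∘ fmap F k) ak.
  by rewrite compmA te_sq -compmA -fmapM (ker_comp ak) fmap0 compm0.
have [k' kE] := @te_lift (te_make f) X k fE.
by exists (te_make f), k'; rewrite kE.
Qed.

Lemma cokernel_lift (X Y : A) (a : hom X Y) :
  exists (K : A) (k : hom Y K), is_cokernel (te_val a) (te_val k).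
Proof.
have [K [k ak]] := cokernel_exists abB (te_val a).
have [|f fE] := @coker_fac _ _ _ _ _ _ _ (k ∘ te_str Y) (cokernel_F ak).
  by rewrite -compmA -te_sq compmA (coker_comp ak) comp0m.
have [k' kE] := @te_lift Y (te_make f) k (esym fE).
by exists (te_make f), k'; rewrite kE.
Qed.

(** The kernel taken in [B] carries a structure map making it a kernel in [A]; if [a] is a
    monomorphism, this kernel map vanishes. *)
Lemma mono_val (X Y : A) (a : hom X Y) : mono a <-> mono (te_val a).
Proof.
split=> [am|]; last exact: mono_reflect.
have [K [k ak]] := kernel_lift a.
have k0 : k = 0 by apply: (mono_eq0 am); apply: ker_comp (kernel_reflect ak).
apply: mono_of_eq0 => W g ag; have [u <-] := ker_fac ak ag.
by rewrite k0 comp0m.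
Qed.

Lemma epi_val (X Y : A) (a : hom X Y) : epi a <-> epi (te_val a).
Proof.
split=> [am|]; last exact: epi_reflect.
have [K [k ak]] := cokernel_lift a.
have k0 : k = 0 by apply: (epi_eq0 am); apply: coker_comp (cokernel_reflect ak).
apply: epi_of_eq0 => W g ag; have [u <-] := coker_fac ak ag.
by rewrite k0 compm0.
Qed.

Lemma kernel_val (X Y K : A) (a : hom X Y) (k : hom K X) :
  is_kernel a k <-> is_kernel (te_val a) (te_val k).
Proof.
split; last exact: kernel_reflect.
move=> ak; apply: is_kernelI.
- exact: (congr1 (@te_val _ _ _ _) (ker_comp ak)).
- exact/mono_val/(ker_mono ak).
have [K' [k' ak']] := kernel_lift a.
have [u uE] := ker_fac ak (ker_comp (kernel_reflect ak')).
by move=> W g /(ker_fac ak') [v <-]; exists (te_val u ∘ v); rewrite compmA -uE.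
Qed.

Lemma cokernel_val (X Y K : A) (a : hom X Y) (k : hom Y K) :
  is_cokernel a k <-> is_cokernel (te_val a) (te_val k).
Proof.
split; last exact: cokernel_reflect.
move=> ak; apply: is_cokernelI.
- exact: (congr1 (@te_val _ _ _ _) (coker_comp ak)).
- exact/epi_val/(coker_epi ak).
have [K' [k' ak']] := cokernel_lift a.
have [u uE] := coker_fac ak (coker_comp (cokernel_reflect ak')).
by move=> W g /(coker_fac ak') [v <-]; exists (v ∘ te_val u); rewrite -compmA -uE.
Qed.

Lemma ses_val (X Y Z : A) (a : hom X Y) (b : hom Y Z) :
  ses a b <-> ses (te_val a) (te_val b).
Proof. by split=> -[/kernel_val ? /cokernel_val ?]; split. Qed.

(* The structure map is the matrix [f_X, 0; gamma, f_K]; any gamma is allowed as F^2 = 0. *)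
Lemma twisted_biproduct (X K : A) (gamma : hom (F (te_base X)) (te_base K))
    S (i1 : hom (te_base X) S) (i2 : hom (te_base K) S) (p1 : hom S (te_base X))
    (p2 : hom S (te_base K)) : is_biproduct i1 i2 p1 p2 ->
  let E := te_make ((i1 ∘ te_str X + i2 ∘ gamma) ∘ fmap F p1
                    + i2 ∘ te_str K ∘ fmap F p2) in
  exists (i : hom K E) (p : hom E X), te_val i = i2 /\ te_val p = p1.
Proof.
move=> hS E.
have [|i iE] := @te_lift K E i2.
  rewrite /= compmDl -!(compmA _ _ (fmap F i2)) -!fmapM (bip12 hS) (bip22 hS).
  by rewrite fmap0 fmap1 compm0 compm1 add0r.
have [|p pE] := @te_lift E X p1; last by exists i, p.
rewrite /= !(compmDl, compmDr) !compmA (bip11 hS) (bip12 hS) !comp0m !addr0.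
by rewrite comp1m.
Qed.

Lemma zero_te (X : A) : zero_object (te_base X) -> zero_object X.
Proof. by move=> [z1 z2]; split=> Y f; apply: te_eq; [apply: z1|apply: z2]. Qed.

Lemma zero_val (X : A) : zero_object X -> zero_object (te_base X).
Proof. by move=> [z1 z2]; apply: zero_id; have := congr1 (@te_val _ _ _ _) (z1 X (idm X)). Qed.

Lemma abelian_te : abelian A.
Proof.
split; [|split; [|split; [|split; [|split]]]].
- have [Z zZ] := zero_exists abB; exists (te_make (0 : hom (F Z) Z)).
  exact: zero_te.
- move=> X Y; have [S [i1 [i2 [p1 [p2 hS]]]]] := biproduct_exists abB (te_base X) (te_base Y).
  pose E := te_make (i1 ∘ te_str X ∘ fmap F p1 + i2 ∘ te_str Y ∘ fmap F p2).
  have [|j1 e1] := @te_lift X E i1.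
    rewrite /= compmDl -!(compmA _ _ (fmap F i1)) -!fmapM (bip21 hS) (bip11 hS).
    by rewrite fmap0 fmap1 compm0 compm1 addr0.
  have [|j2 e2] := @te_lift Y E i2.
    rewrite /= compmDl -!(compmA _ _ (fmap F i2)) -!fmapM (bip12 hS) (bip22 hS).
    by rewrite fmap0 fmap1 compm0 compm1 add0r.
  have [|q1 h1] := @te_lift E X p1.
    by rewrite /= compmDr !compmA (bip11 hS) (bip12 hS) !comp0m comp1m addr0.
  have [|q2 h2] := @te_lift E Y p2.
    by rewrite /= compmDr !compmA (bip21 hS) (bip22 hS) !comp0m comp1m add0r.
  by exists E, j1, j2, q1, q2; case: (hS) => *; split; apply: te_eq;
    rewrite /= ?e1 ?e2 ?h1 ?h2.
- by move=> X Y a; have [K [k /kernel_val h]] := kernel_lift a; exists K, k.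
- by move=> X Y a; have [K [k /cokernel_val h]] := cokernel_lift a; exists K, k.
- move=> X Y a am; have [K [k ak]] := cokernel_lift a; exists K, k.
  by apply: kernel_reflect; apply: mono_kernel ak => //; apply/mono_val.
- move=> X Y a am; have [K [k ak]] := kernel_lift a; exists K, k.
  by apply: cokernel_reflect; apply: epi_cokernel ak => //; apply/epi_val.
Qed.

Lemma exact_val (X Y Z : A) (a : hom X Y) (b : hom Y Z) :
  exact a b -> exact (te_val a) (te_val b).
Proof.
case/(exactP abelian_te)=> I [m [e [-> /epi_val ee /kernel_val bm]]].
by apply/(exactP abB); exists (te_base I), (te_val m), (te_val e).
Qed.

(* The left adjoint X |-> X + F X of the forgetful functor. *)
Section Free.
Variables (X S : B) (i1 : hom X S) (i2 : hom (F X) S) (p1 : hom S X) (p2 : hom S (F X)).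
Hypothesis hS : is_biproduct i1 i2 p1 p2.

Definition free_te : A := te_make (i2 ∘ fmap F p1).

(** On the summand [F X] a morphism is forced by compatibility: it equals [te_str Y] composed with
    [F] of its restriction to [X]. *)
Lemma free_te_eq (Y : A) (a b : hom free_te Y) :
  te_val a ∘ i1 = te_val b ∘ i1 -> a = b.
Proof.
move=> ab; apply: te_eq; apply: (bip_in hS) => //.
have E (c : hom free_te Y) : te_val c ∘ i2 = te_str Y ∘ fmap F (te_val c ∘ i1).
  by rewrite fmapM compmA -te_sq /= -!compmA -fmapM (bip11 hS) fmap1 compm1.
by rewrite !E ab.
Qed.

Lemma free_te_map (Y : A) (b : hom X (te_base Y)) :
  exists a : hom free_te Y, te_val a = b ∘ p1 + te_str Y ∘ fmap F b ∘ p2.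
Proof.
apply: te_lift; rewrite /= compmDl !compmA.
rewrite -(compmA _ p1) -(compmA _ p2) (bip12 hS) (bip22 hS) compm0 comp0m add0r compm1.
by rewrite fmapD compmDr !fmapM !compmA te_strK !comp0m addr0.
Qed.

Lemma free_te_lift (Y : A) (b : hom X (te_base Y)) :
  exists a : hom free_te Y, te_val a ∘ i1 = b.
Proof.
have [a aE] := free_te_map b; exists a.
by rewrite aE compmDl -!compmA (bip11 hS) (bip21 hS) !compm0 addr0 compm1.
Qed.

Lemma projective_free : projectives B X -> projectives A free_te.
Proof.
move=> pX Y Z p f /epi_val pe; have [b bE] := pX _ _ _ (te_val f ∘ i1) pe.
have [a aE] := free_te_lift b; exists a; apply: free_te_eq.
by rewrite te_valM -compmA aE.
Qed.

(** Since [F(i2)] has source [F (F X)] it is zero, so applying [F] to the biproduct identity makes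
    [F(p1)] a split monomorphism. *)
Lemma mono_free : mono (te_str free_te).
Proof.
apply: mono_comp; first exact: split_mono (bip22 hS).
apply: (@split_mono _ _ _ _ (fmap F i1)).
have [_ _ _ _ h] := hS.
by rewrite -fmapM -fmap1 -h fmapD !fmapM (FF_eq (fmap F i2) 0) comp0m addr0.
Qed.

End Free.

Lemma projective_trivial (P : B) :
  projectives B P -> zero_object (F P) -> projectives A (te_make (0 : hom (F P) P)).
Proof.
move=> pP FP0 Y Z p f /epi_val pe; have [b bE] := pP _ _ _ (te_val f) pe.
have [|a aE] := @te_lift (te_make (0 : hom (F P) P)) Y b.
  by rewrite [LHS](zero_hom0 _ FP0) [RHS](zero_hom0 _ FP0).
by exists a; apply: te_eq; rewrite te_valM aE.
Qed.

Lemma injective_trivial (J : B) :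
  injectives B J -> injectives A (te_make (0 : hom (F (G J)) (G J))).
Proof.
move=> iJ Y Z m f /mono_val mm.
have [b bE] := injective_G iJ (te_val f) mm.
have [|a aE] := @te_lift Z (te_make (0 : hom (F (G J)) (G J))) b.
  by rewrite [LHS]hom_F_G_eq0 [RHS]hom_F_G_eq0.
by exists a; apply: te_eq; rewrite te_valM aE.
Qed.

(* The right adjoint J |-> J + G J of the forgetful functor. *)
Section Cofree.
Variables (J S : B) (i1 : hom J S) (i2 : hom (G J) S) (p1 : hom S J) (p2 : hom S (G J)).
Hypothesis hS : is_biproduct i1 i2 p1 p2.
Variable eps : hom (F (G J)) J.
Hypothesis epsE : phi eps = idm (G J).

Definition cofree_te : A := te_make (i1 ∘ eps ∘ fmap F p2).

(** The component in [G J] is forced: it is the transpose of the component in [J] composed with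
    [te_str Y]. *)
Lemma cofree_te_eq (Y : A) (a b : hom Y cofree_te) :
  p1 ∘ te_val a = p1 ∘ te_val b -> a = b.
Proof.
move=> ab; apply: te_eq; apply: (bip_out hS) => //.
have E (c : hom Y cofree_te) : p2 ∘ te_val c = phi (p1 ∘ te_val c ∘ te_str Y).
  rewrite -compmA (te_sq c) /= !compmA (bip11 hS) comp1m -compmA -fmapM phi_comp epsE.
  by rewrite comp1m.
by rewrite !E ab.
Qed.

Lemma cofree_te_map (Y : A) (b : hom (te_base Y) J) :
  exists a : hom Y cofree_te, te_val a = i1 ∘ b + i2 ∘ phi (b ∘ te_str Y).
Proof.
apply: te_lift; rewrite /= compmDl -(compmA i2) -phi_comp -(compmA b) te_strK compm0.
rewrite phi0 compm0 addr0 -[in RHS](compmA _ (fmap F p2)) -fmapM compmDr !compmA.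
rewrite (bip21 hS) (bip22 hS) comp0m add0r comp1m -!compmA; congr (_ ∘ _).
by apply: phi_inj; rewrite phi_comp epsE comp1m.
Qed.

Lemma cofree_te_lift (Y : A) (b : hom (te_base Y) J) :
  exists a : hom Y cofree_te, p1 ∘ te_val a = b.
Proof.
have [a aE] := cofree_te_map b; exists a.
by rewrite aE compmDr !compmA (bip11 hS) (bip12 hS) comp0m addr0 comp1m.
Qed.

Lemma injective_cofree : injectives B J -> injectives A cofree_te.
Proof.
move=> iJ Y Z m f /mono_val mm; have [b bE] := iJ _ _ _ (p1 ∘ te_val f) mm.
have [a aE] := cofree_te_lift b; exists a; apply: cofree_te_eq.
by rewrite te_valM compmA aE.
Qed.

End Cofree.

Lemma eps_exists J : exists eps : hom (F (G J)) J, phi eps = idm (G J).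
Proof. exact: phi_surj. Qed.

(** * Enough projectives and injectives *)

Lemma projective_cover (X : A) : exists (Q S : B) (i1 : hom Q S) (i2 : hom (F Q) S)
    (p1 : hom S Q) (p2 : hom S (F Q)) (p : hom (free_te i2 p1) X),
  [/\ is_biproduct i1 i2 p1 p2, projectives B Q & epi p].
Proof.
have [Q [q [pQ qe]]] := epB (te_base X).
have [S [i1 [i2 [p1 [p2 hS]]]]] := biproduct_exists abB Q (F Q).
have [p pE] := free_te_lift hS q.
exists Q, S, i1, i2, p1, p2, p; split=> //; apply/epi_val.
by apply: (@epi_cancel _ _ _ _ _ i1); rewrite pE.
Qed.

Lemma injective_hull (X : A) : exists (J S : B) (i1 : hom J S) (i2 : hom (G J) S)
    (p1 : hom S J) (p2 : hom S (G J)) (eps : hom (F (G J)) J)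
    (m : hom X (cofree_te i1 p2 eps)),
  [/\ is_biproduct i1 i2 p1 p2, phi eps = idm (G J), injectives B J & mono m].
Proof.
have [J [j [iJ jm]]] := eiB (te_base X).
have [S [i1 [i2 [p1 [p2 hS]]]]] := biproduct_exists abB J (G J).
have [eps epsE] := eps_exists J; have [m mE] := cofree_te_lift hS epsE j.
exists J, S, i1, i2, p1, p2, eps, m; split=> //; apply/mono_val.
by apply: (@mono_cancel _ _ _ _ p1); rewrite mE.
Qed.

Lemma enough_projectives_te : enough_projectives A.
Proof.
move=> X; have [Q [S [i1 [i2 [p1 [p2 [p [hS pQ pe]]]]]]]] := projective_cover X.
by exists (free_te i2 p1), p; split=> //; apply: projective_free hS pQ.
Qed.

Lemma enough_injectives_te : enough_injectives A.
Proof.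
move=> X; have [Q [S [i1 [i2 [p1 [p2 [eps [m [hS eE iJ pe]]]]]]]]] := injective_hull X.
by exists (cofree_te i1 p2 eps), m; split=> //; exact: (injective_cofree hS eE iJ).
Qed.

(** [P] is a retract of a free object on a projective [Q], whose base is the sum of [Q] and [F Q],
    both projective. *)
Lemma projective_val (P : A) : projectives A P -> projectives B (te_base P).
Proof.
move=> pP; have [Q [S [i1 [i2 [p1 [p2 [p [hS pQ pe]]]]]]]] := projective_cover P.
have [s ps] := projective_section pP pe.
apply: projective_retract (congr1 (@te_val _ _ _ _) ps) _.
exact: projective_biproduct hS pQ (projF pQ).
Qed.

Lemma injective_val (I : A) : injectives A I -> injectives B (te_base I).
Proof.
move=> iI; have [J [S [i1 [i2 [p1 [p2 [eps [m [hS eE iJ mm]]]]]]]]] := injective_hull I.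
have [r rm] := injective_retraction iI mm.
apply: injective_retract (congr1 (@te_val _ _ _ _) rm) _.
exact: injective_biproduct hS iJ (injective_G iJ).
Qed.

(** * Homological dimensions in the trivial extension *)

Lemma pd_le_val n (X : A) : pd_le A n X -> pd_le B n (te_base X).
Proof.
case=> [[P d a pP ae ea ex]] /= z.
unshelve eexists (@ProjResolution B (te_base X) (fun k => te_base (P k))
  (fun k => te_val (d k)) (te_val a) _ _ _ _).
- by move=> k; apply: projective_val.
- exact/epi_val.
- exact: exact_val ea.
- by move=> k; exact: exact_val (ex k).
- by move=> k /z/zero_val.
Qed.

Lemma id_le_val n (X : A) : id_le A n X -> id_le B n (te_base X).
Proof.
case=> [[P d a pP ae ea ex]] /= z.
unshelve eexists (@InjResolution B (te_base X) (fun k => te_base (P k))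
  (fun k => te_val (d k)) (te_val a) _ _ _ _).
- by move=> k; apply: injective_val.
- exact/mono_val.
- exact: exact_val ea.
- by move=> k; exact: exact_val (ex k).
- by move=> k /z/zero_val.
Qed.

Lemma pd_finite_val (X : A) : pd_finite A X -> projectives B (te_base X).
Proof. by case=> n /pd_le_val; apply: pd_le_projective. Qed.

Lemma id_finite_val (X : A) : id_finite A X -> injectives B (te_base X).
Proof.
case=> n /id_le_val; rewrite id_le_opp // injectives_opp.
by apply: pd_le_projective; [apply: abelian_opp|rewrite -injectives_opp -projectives_opp].
Qed.

Lemma pd_le1_te (X : A) : projectives B (te_base X) -> pd_le A 1 X.
Proof.
move=> pX; have [S [i1 [i2 [p1 [p2 hS]]]]] := biproduct_exists abB (te_base X) (F (te_base X)).
have [p pE] := free_te_map hS (idm (te_base X)).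
pose K := te_make (0 : hom (F (F (te_base X))) (F (te_base X))).
(* The counit [p] is the identity on [X] and [te_str X] on [F X], so its kernel is [F X] embedded
   with components [- te_str X] and the identity. *)
have [|k kE] := @te_lift K (free_te i2 p1) (i2 - i1 ∘ te_str X); first exact: FF_eq.
rewrite comp1m fmap1 compm1 in pE.
have pi1 : te_val p ∘ i1 = idm _.
  by rewrite pE compmDl -compmA (bip11 hS) (bip21 hS) compm0 addr0.
have pi2 : te_val p ∘ i2 = te_str X.
  by rewrite pE compmDl -compmA (bip12 hS) (bip22 hS) compm1 add0r.
have kp : is_kernel p k.
  apply: kernel_reflect; rewrite kE; apply: is_kernelI.
  - by rewrite compmBr compmA pi1 pi2 comp1m subrr.
  - apply: (@split_mono _ _ _ _ p2).
    by rewrite compmBr compmA (bip21 hS) (bip22 hS) comp0m subr0.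
  - move=> W g; rewrite pE compmDl => /eqP; rewrite addr_eq0 => /eqP g1.
    exists (p2 ∘ g); apply: (bip_out hS).
      by rewrite compmA compmBr !compmA (bip11 hS) (bip12 hS) sub0r comp1m !compNm g1.
    by rewrite compmA compmBr !compmA (bip21 hS) (bip22 hS) comp0m subr0 comp1m.
apply: (pd_le1I abelian_te (m := k) (e := p)).
- split=> //; apply: epi_cokernel kp; first exact: abelian_te.
  exact/epi_val/(split_epi pi1).
- by apply: projective_trivial (F2_0 _); apply: projF.
- exact: projective_free hS pX.
Qed.

Lemma id_le1_te (X : A) : injectives B (te_base X) -> id_le A 1 X.
Proof.
move=> iX; have [S [i1 [i2 [p1 [p2 hS]]]]] := biproduct_exists abB (te_base X) (G (te_base X)).
have [eps epsE] := eps_exists (te_base X).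
have [m mE] := cofree_te_map hS epsE (idm (te_base X)).
pose Q := te_make (0 : hom (F (G (te_base X))) (G (te_base X))).
(* Dually, the unit [m] has components the identity and [phi (te_str X)]; its cokernel [G X]
   measures the failure of the second component to be determined by the first. *)
have [|c cE] := @te_lift (cofree_te i1 p2 eps) Q (p2 - phi (te_str X) ∘ p1).
  by rewrite [LHS]hom_F_G_eq0 [RHS]hom_F_G_eq0.
rewrite compm1 comp1m in mE.
have p1m : p1 ∘ te_val m = idm _.
  by rewrite mE compmDr compmA (bip11 hS) (bip12 hS) comp0m addr0.
have p2m : p2 ∘ te_val m = phi (te_str X).
  by rewrite mE compmDr compmA (bip21 hS) (bip22 hS) comp1m add0r.
have mc : is_cokernel m c.
  apply: cokernel_reflect; rewrite cE; apply: is_cokernelI.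
  - by rewrite compmBl -compmA p1m p2m compm1 subrr.
  - apply: (@split_epi _ _ _ i2).
    by rewrite compmBl -compmA (bip12 hS) (bip22 hS) compm0 subr0.
  - move=> W g; rewrite mE compmDr => /eqP; rewrite addr_eq0 => /eqP g1.
    exists (g ∘ i2); apply: (bip_in hS).
      by rewrite -compmA compmBl -!compmA (bip11 hS) (bip21 hS) sub0r compm1 !compmN g1.
    by rewrite -compmA compmBl -!compmA (bip12 hS) (bip22 hS) compm0 subr0 compm1.
rewrite id_le_opp; last exact: abelian_te.
apply: (@pd_le1I (opp A) (abelian_opp abelian_te) Q (cofree_te i1 p2 eps) X c m).
- split=> //; apply: (@mono_kernel A abelian_te _ _ _ m c) => //.
  exact/mono_val/(split_mono p1m).
- by rewrite -injectives_opp; apply: injective_trivial.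
- by rewrite -injectives_opp; exact: (injective_cofree hS epsE iX).
Qed.

Lemma fmapB (X Y : B) (f g : hom X Y) : fmap F (f - g) = fmap F f - fmap F g.
Proof. by apply/eqP; rewrite -subr_eq opprK -fmapD subrK. Qed.

(** * The class Delta(B) *)

Lemma DeltaP (X : A) : Delta F [set: B] X <-> mono (te_str X).
Proof.
split=> [[]//|fm]; split=> //.
by have [Q [q h]] := cokernel_exists abB (te_str X); exists Q, q.
Qed.

Lemma Delta_sub (X Y : A) (m : hom X Y) :
  mono m -> mono (te_str Y) -> mono (te_str X).
Proof.
move=> /mono_val mm mY; apply: (@mono_cancel _ _ _ _ (te_val m)).
by rewrite te_sq; apply: mono_comp => //; apply: mono_F.
Qed.

Lemma projective_Delta (P : A) : projectives A P -> mono (te_str P).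
Proof.
move=> pP; have [Q [S [i1 [i2 [p1 [p2 [p [hS pQ pe]]]]]]]] := projective_cover P.
have [s ps] := projective_section pP pe.
by apply: (Delta_sub (m := s)); [exact: split_mono ps|exact: mono_free hS].
Qed.

(* Ext^1(X, Y) is the cokernel of beta |-> beta f_X - f_Y F(beta). The correction
   f_Y delta is annihilated by f_Y F(-) because f_Y F(f_Y) = 0. *)
Lemma Delta_solve (X Y : A) (gamma : hom (F (te_base X)) (te_base Y)) :
  mono (te_str X) -> injectives B (te_base Y) ->
  exists beta, beta ∘ te_str X - te_str Y ∘ fmap F beta = gamma.
Proof.
move=> mX iY; have [beta bE] := iY _ _ _ gamma mX.
have [delta dE] := injective_F iY (fmap F beta) mX.
exists (beta + te_str Y ∘ delta).
rewrite compmDl bE fmapD fmapM compmDr !compmA te_strK comp0m addr0.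
by rewrite -(compmA _ delta) dE addrK.
Qed.

(** An extension [b] of [a] in [B] need not respect the structure maps. Its defect vanishes on
    [F Z], so it comes from some [gamma] on [F X]; solving for [gamma] by [Delta_solve] gives a
    correction along [c], which leaves the restriction to [Z] unchanged. *)
Lemma Delta_extension (Z P X Y : A) (m : hom Z P) (c : hom P X) :
  ses m c -> mono (te_str X) -> injectives B (te_base Y) ->
  forall a : hom Z Y, exists b : hom P Y, b ∘ m = a.
Proof.
move=> /ses_val mc mX iY a.
have [b bE] := iY _ _ _ (te_val a) (ses_mono mc).
have [|gamma gE] := @coker_fac _ _ _ _ _ _ _
  (b ∘ te_str P - te_str Y ∘ fmap F b) (cokernel_F mc.2).
  rewrite compmBl -compmA -te_sq compmA bE -compmA -fmapM bE te_sq.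
  by rewrite subrr.
have [b' b'E] := Delta_solve gamma mX iY.
have [|d dE] := @te_lift P Y (b - b' ∘ te_val c).
  apply/eqP; rewrite -subr_eq0 compmBl fmapB fmapM compmBr -compmA te_sq !compmA.
  by rewrite opprD opprK addrACA -gE -b'E compmBl addrACA subrr add0r addNr.
exists d; apply: te_eq.
by rewrite te_valM dE compmBl bE -compmA (ker_comp mc.1) compm0 subr0.
Qed.

Lemma Delta_Ext_zero (X Y : A) i : (1 <= i)%N -> mono (te_str X) ->
  injectives B (te_base Y) -> Ext_zero i X Y.
Proof.
move=> i1 mX iY.
apply: (@Ext_zero_of_extension _ abelian_te [set X : A | mono (te_str X)]) => //.
  by move=> Z P D m e me mD a; apply: Delta_extension me mD iY a.
by move=> Z P m mm /projective_Delta; exact: Delta_sub mm.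
Qed.

(** The test object is [(J, 0)] with [gamma] an embedding of [F X] into an injective [J]. Vanishing
    of Ext lets [gamma] factor through [te_str X], which is then a monomorphism. *)
Lemma Delta_of_Ext_zero (X : A) :
  (forall Y : A, injectives B (te_base Y) -> Ext_zero 1 X Y) -> mono (te_str X).
Proof.
move=> hX; have [P [c [pP ce]]] := enough_projectives_te X.
have [Z [m mc]] := epi_ses abelian_te ce.
have [J [gamma [iJ gm]]] := eiB (F (te_base X)).
pose Y := te_make (0 : hom (F J) J).
have [delta dE] := iJ _ _ _ (gamma ∘ fmap F (te_val c)) (projective_Delta pP).
have cm0 : te_val c ∘ te_val m = 0 := congr1 (@te_val _ _ _ _) (ker_comp mc.1).
(* On [Z], [delta ∘ te_str P] becomes [gamma ∘ F(c ∘ m) = 0], so [delta ∘ m] is a morphism to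
   [(J, 0)]. Its extension [b] kills [te_str P], hence [delta - b] still extends [gamma ∘ F(c)] and
   descends to [X]. *)
have [|a aE] := @te_lift Z Y (delta ∘ te_val m).
  by rewrite -compmA te_sq compmA dE -compmA -fmapM cm0 fmap0 compm0 comp0m.
have [b bE] := Ext_zero1_extension abelian_te enough_projectives_te mc pP (hX Y iJ) a.
have bm : te_val b ∘ te_val m = te_val a := congr1 (@te_val _ _ _ _) bE.
have bs : te_val b ∘ te_str P = 0 by rewrite te_sq /= comp0m.
have [|eps eE] := @coker_fac _ _ _ _ _ _ _ (delta - te_val b) (proj2 (proj1 (ses_val _ _) mc)).
  by rewrite compmBl bm aE subrr.
apply: (@mono_cancel _ _ _ _ eps).
suff -> : eps ∘ te_str X = gamma by [].
apply: (epi_F (proj1 (epi_val _) ce)).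
by rewrite -compmA -te_sq compmA eE compmBl bs subr0.
Qed.

(** The third hypothesis says that [X] meets [F Y] inside [Y] only in [F X], which is what keeps
    [F D] from collapsing in [D]. *)
Lemma Delta_cokernel (X Y D : A) (u : hom X Y) (c : hom Y D) :
  ses u c -> mono (te_str Y) ->
  (forall W (t : hom W (F (te_base Y))) (x : hom W (te_base X)),
     te_str Y ∘ t = te_val u ∘ x -> exists y, te_str X ∘ y = x) ->
  mono (te_str D).
Proof.
move=> /ses_val uc mY cart; apply: mono_of_eq0 => W d d0.
(* A projective cover of [W] replaces the choice of an element: over it [d] lifts along [F(c)]. *)
have [P [q [pP qe]]] := epB W.
have [t tE] := pP _ _ _ (d ∘ q) (epi_F (ses_epi uc)).
have [|x xE] := @ker_fac _ _ _ _ _ _ _ (te_str Y ∘ t) uc.1.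
  by rewrite compmA te_sq -compmA tE compmA d0 comp0m.
have [y yE] := cart _ _ _ (esym xE).
have {}tE' : t = fmap F (te_val u) ∘ y.
  by apply: mY; rewrite -xE -yE !compmA te_sq.
apply: (epi_eq0 qe); rewrite -tE tE' compmA -fmapM (ker_comp uc.1).
by rewrite fmap0 comp0m.
Qed.

(* X embeds into the free object on an injective J containing C = Coker f_X:
   the components are X -> C -> J and an extension of F X -> F C -> F J along f_X.
   F X -> F C is a monomorphism because F^2 = 0. *)
Lemma Delta_embedding (X : A) : mono (te_str X) ->
  exists (P D : A) (u : hom X P) (c : hom P D),
    [/\ ses u c, projectives A P & mono (te_str D)].
Proof.
move=> mX; have [Q [q fq]] := mono_ses abB mX; have [J [j [iJ jm]]] := eiB Q.
have [S [i1 [i2 [p1 [p2 hS]]]]] := biproduct_exists abB J (F J).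
have [b bE] := injective_F iJ (fmap F (j ∘ q)) mX.
have [|u uE] := @te_lift X (free_te i2 p1) (i1 ∘ (j ∘ q) + i2 ∘ b).
  rewrite /= compmDl -(compmA i2) bE -(compmA i1) -(compmA j) (ker_comp fq.1).
  rewrite !compm0 add0r -[in RHS]compmA -fmapM compmDr !compmA.
  by rewrite (bip11 hS) (bip12 hS) !comp0m addr0 comp1m.
have u1 : p1 ∘ te_val u = j ∘ q.
  by rewrite uE compmDr !compmA (bip11 hS) (bip12 hS) !comp0m addr0 comp1m.
have u2 : p2 ∘ te_val u = b.
  by rewrite uE compmDr !compmA (bip21 hS) (bip22 hS) !comp0m add0r comp1m.
have fac W (x : hom W (te_base X)) : p1 ∘ te_val u ∘ x = 0 ->
    exists y, te_str X ∘ y = x.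
  by rewrite u1 -compmA => /(mono_eq0 jm); apply: ker_fac fq.1.
have Fq : mono (fmap F q).
  apply: mono_of_eq0 => W g /(ker_fac (ses_F fq).1)[y <-].
  by rewrite (FF_eq (fmap F (te_str X)) 0) comp0m.
have um : mono u.
  apply/mono_val; apply: mono_of_eq0 => W x x0.
  have [|y yE] := fac _ x; first by rewrite -compmA x0 compm0.
  have y0 : y = 0.
    apply: (mono_eq0 (mono_comp (mono_F jm) Fq)).
    by rewrite -fmapM -bE -compmA yE -u2 -compmA x0 compm0.
  by rewrite -yE y0 compm0.
have [D [c uc]] := mono_ses abelian_te um.
exists (free_te i2 p1), D, u, c; split=> //.
  by apply: projective_free hS _; rewrite projinj.
apply: (Delta_cokernel uc); first exact: mono_free hS.
move=> W t x tx; apply: fac; rewrite -compmA -tx /= !compmA (bip12 hS).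
by rewrite !comp0m.
Qed.

(** The counit of the free object on [Y] extends to a projective [P] containing that free object
    with cokernel in Delta. Composing with the inclusion of [Y] into the free object exhibits [Y] as
    a retract of [P] in [B]. *)
Lemma injective_of_Ext_zero (Y : A) :
  (forall X : A, mono (te_str X) -> Ext_zero 1 X Y) -> injectives B (te_base Y).
Proof.
move=> hY.
have [S [i1 [i2 [p1 [p2 hS]]]]] := biproduct_exists abB (te_base Y) (F (te_base Y)).
have [a aE] := free_te_lift hS (idm (te_base Y)).
have [P [D [u [c [uc pP mD]]]]] := Delta_embedding (mono_free hS).
have [b bE] := Ext_zero1_extension abelian_te enough_projectives_te uc pP (hY D mD) a.
apply: (@injective_retract _ _ (te_base P) (te_val u ∘ i1) (te_val b)).
  by rewrite compmA -[_ ∘ te_val u]/(te_val (b ∘ u)) bE.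
by rewrite -projinj; apply: projective_val.
Qed.

Lemma Delta_cover (X : A) : mono (te_str X) ->
  exists (P D : A) (k : hom D P) (p : hom P X),
    [/\ ses k p, projectives A P & mono (te_str D)].
Proof.
move=> mX; have [P [p [pP pe]]] := enough_projectives_te X.
have [D [k kp]] := epi_ses abelian_te pe; exists P, D, k, p; split=> //.
exact: Delta_sub (ses_mono kp) (projective_Delta pP).
Qed.

(* Delta is closed under syzygies and cosyzygies, which splice to a complete
   resolution; it is Hom(-, Q)-acyclic as Q has injective base. *)
Lemma GP_Delta : GP A = Delta F [set: B].
Proof.
apply/seteqP; split=> X.
  case=> P [pP _ [m [Q [q [_ /ker_mono mm]]]]]; apply/DeltaP.
  exact: Delta_sub mm (projective_Delta (pP _)).
move=> /DeltaP mX.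
(* The guard makes the relation satisfiable for every object, so that choice yields a total
   function; outside Delta the value is a dummy. *)
pose R (X Y : A) := (mono (te_str X) -> mono (te_str Y) /\
  exists (P : A) (u : hom X P) (c : hom P Y), ses u c /\ projectives A P)%type.
pose R' (X Y : A) := (mono (te_str X) -> mono (te_str Y) /\
  exists (P : A) (u : hom Y P) (c : hom P X), ses u c /\ projectives A P)%type.
have [co coP] : {f : A -> A & forall X, R X (f X)}.
  apply: choice => Y; have [mY|nY] := pselect (mono (te_str Y)); last by exists Y.
  have [P [D [u [c [uc pP mD]]]]] := Delta_embedding mY.
  by exists D => _; split=> //; exists P, u, c.
have [sy syP] : {f : A -> A & forall X, R' X (f X)}.
  apply: choice => Y; have [mY|nY] := pselect (mono (te_str Y)); last by exists Y.
  have [P [D [u [c [uc pP mD]]]]] := Delta_cover mY.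
  by exists D => _; split=> //; exists P, u, c.
(* [Z 0] is [X], positive indices are cosyzygies, and [Negz n], which is [-(n + 1)], is the syzygy
   of order [n.+1]. *)
pose Z (i : int) : A := match i with Posz n => iter n co X | Negz n => iter n.+1 sy X end.
have mZ i : mono (te_str (Z i)).
  case: i => n; first by elim: n => //= n IH; case: (coP _ IH).
  by rewrite /Z; elim: n.+1 => //= k IH; case: (syP _ IH).
have H i : exists t : {P : A & (hom (Z i) P * hom P (Z (i + 1)%R))%type},
    ses (projT2 t).1 (projT2 t).2 /\ projectives A (projT1 t).
  have [P [u [c [uc pP]]]] : exists (P : A) (u : hom (Z i) P) (c : hom P (Z (i + 1)%R)),
      ses u c /\ projectives A P.
    case: i => n.
      have -> : Posz n + 1 = Posz n.+1 by rewrite -PoszD addn1.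
      by have [] := coP _ (mZ (Posz n)).
    case: n => [|n]; first by have [] := syP _ mX.
    have -> : Negz n.+1 + 1 = Negz n by rewrite !NegzE -addn1 PoszD opprD addrNK.
    by have [] := syP _ (mZ (Negz n)).
  by exists (existT _ P (u, c)).
pose t i := projT1 (cid (H i)).
have tP i : ses (projT2 (t i)).1 (projT2 (t i)).2 /\ projectives A (projT1 (t i)) :=
  projT2 (cid (H i)).
pose d (i : int) : hom (projT1 (t i)) (projT1 (t (i + 1))) :=
  (projT2 (t (i + 1))).1 ∘ (projT2 (t i)).2.
have dex i : exact (d i) (d (i + 1)).
  apply: exact_splice (tP _).1 (ses_epi (tP _).1) (ses_mono (tP _).1).
  exact: abelian_te.
exists (AcyclicComplex dex); split=> [i||].
- exact: (tP i).2.
- move=> Q /projective_val; rewrite projinj => iQ i f /= fd.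
  (* A cocycle descends to the next syzygy, whose inclusion into its projective has cokernel in
     Delta, so the descended map extends. *)
  have [f' f'E] : exists f', f' ∘ (projT2 (t (i + 1))).2 = f.
    apply: coker_fac (tP (i + 1)).1.2 _; apply: (epi_eq0 (ses_epi (tP i).1)).
    by rewrite -compmA.
  have [g gE] := Delta_extension (tP (i + 1 + 1)).1 (mZ _) iQ f'.
  by exists g; rewrite -f'E -gE -compmA.
(* The index [-1 + 1] computes to [0], so the image of [d (-1)] is [Z 0], that is [X]. *)
- exists (projT2 (t (-1 + 1))).1.
  apply: is_imageI (ses_mono (tP _).1) (ses_epi (tP _).1).
  exact: abelian_te.
Qed.

(* The twist gamma : F X -> J -> T J by an embedding of F X into an injective J makes
   the structure map of the extension of X by the free object T J a monomorphism. *)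
Lemma twisting_morphism (X : A) : exists (K : A) (gamma : hom (F (te_base X)) (te_base K)),
  injectives B (te_base K) /\
  forall (Y : A) (u : hom Y X) S (i1 : hom (te_base Y) S) (i2 : hom (te_base K) S)
      (p1 : hom S (te_base Y)) (p2 : hom S (te_base K)), is_biproduct i1 i2 p1 p2 ->
    mono (fmap F (te_val u)) ->
    mono ((i1 ∘ te_str Y + i2 ∘ (gamma ∘ fmap F (te_val u))) ∘ fmap F p1
                    + i2 ∘ te_str K ∘ fmap F p2).
Proof.
have [J [j [iJ jm]]] := eiB (F (te_base X)).
have [T [k1 [k2 [q1 [q2 hT]]]]] := biproduct_exists abB J (F J).
exists (free_te k2 q1), (k1 ∘ j); split.
  exact: injective_biproduct hT iJ (injective_F iJ).
move=> Y u S i1 i2 p1 p2 hS um; apply: mono_of_eq0 => W g h.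
(* Projecting to [K] and then to its summands separates the two contributions: the twist lands in
   [J], the structure map of [K] in [F J]. *)
have := congr1 (compm p2) h.
rewrite compm0 !(compmDl, compmDr) !compmA (bip21 hS) (bip22 hS) !(comp0m, comp1m) add0r => h'.
have := congr1 (compm q2) h'.
rewrite compm0 !compmDr !compmA (bip21 hT) (bip22 hT) !comp0m add0r comp1m => g2.
have := congr1 (compm q1) h'.
rewrite compm0 !compmDr !compmA (bip11 hT) (bip12 hT) !comp0m addr0 comp1m => g1.
have p1g : fmap F p1 ∘ g = 0 by apply: (mono_eq0 (mono_comp jm um)); rewrite compmA.
have p2g : fmap F p2 ∘ g = 0.
  by apply: (mono_eq0 (mono_free hT)); rewrite /= compmA -!(compmA k2) g2 compm0.
have [_ _ _ _ hid] := hS.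
by rewrite -(comp1m g) -fmap1 -hid fmapD !fmapM compmDl -!compmA p1g p2g !compm0 addr0.
Qed.

(** The first sequence is the twisted extension of [X] by [K]. For the second, [X] is embedded in an
    injective [I] with cokernel [C], and the twisted extension of [C] by [K] is pulled back along
    [c]. *)
Lemma complete_Delta : complete (Delta F [set: B], Uinv F (injectives B)).
Proof.
move=> X; split.
  have [K [gamma [iK hK]]] := twisting_morphism X.
  have [S [i1 [i2 [p1 [p2 hS]]]]] := biproduct_exists abB (te_base X) (te_base K).
  have [i [p [iE pE]]] := twisted_biproduct (X := X) (K := K) gamma hS.
  exists K, (te_make ((i1 ∘ te_str X + i2 ∘ gamma) ∘ fmap F p1
                    + i2 ∘ te_str K ∘ fmap F p2)), i, p; split=> //.
    apply/DeltaP => /=; have := hK X (idm X) _ _ _ _ _ hS.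
    by rewrite /= fmap1 compm1; apply; exact: mono_id.
  apply/(short_exactP abelian_te)/ses_val; rewrite iE pE; exact: ses_bip hS.
have [I [j [iI jm]]] := enough_injectives_te X.
have [C [c jc]] := mono_ses abelian_te jm.
have [K [gamma [iK hK]]] := twisting_morphism C.
have [S [i1 [i2 [p1 [p2 hS]]]]] := biproduct_exists abB (te_base I) (te_base K).
have [T [k1 [k2 [q1 [q2 hT]]]]] := biproduct_exists abB (te_base C) (te_base K).
(* [E] is the pullback of [L] along [c]: its twist is [gamma ∘ F(c)], and [E] maps onto [L] with the
   same kernel [X] as [I] onto [C]. *)
pose E := te_make ((i1 ∘ te_str I + i2 ∘ (gamma ∘ fmap F (te_val c))) ∘ fmap F p1
                    + i2 ∘ te_str K ∘ fmap F p2).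
pose L := te_make ((k1 ∘ te_str C + k2 ∘ gamma) ∘ fmap F q1
                    + k2 ∘ te_str K ∘ fmap F q2).
have /ses_val [kc cj] := jc.
have [|m mE] := @te_lift X E (i1 ∘ te_val j).
  rewrite /= compmDl -!(compmA _ _ (fmap F (i1 ∘ _))) -!fmapM !compmA.
  rewrite (bip11 hS) (bip21 hS) comp0m fmap0 compm0 addr0 comp1m compmDl.
  rewrite -!compmA -!fmapM (ker_comp kc) fmap0 !compm0 addr0.
  by rewrite te_sq.
pose b := k1 ∘ te_val c ∘ p1 + k2 ∘ p2.
have q1b : q1 ∘ b = te_val c ∘ p1.
  by rewrite compmDr !compmA (bip11 hT) (bip12 hT) comp0m addr0 comp1m.
have q2b : q2 ∘ b = p2.
  by rewrite compmDr !compmA (bip21 hT) (bip22 hT) !comp0m add0r comp1m.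
have bi1 : b ∘ i1 = k1 ∘ te_val c.
  by rewrite compmDl -!compmA (bip11 hS) (bip21 hS) !compm0 addr0 compm1.
have bi2 : b ∘ i2 = k2.
  by rewrite compmDl -!compmA (bip12 hS) (bip22 hS) !compm0 add0r compm1.
have [|e eE] := @te_lift E L b.
  rewrite /= [RHS]compmDl -!(compmA _ _ (fmap F b)) -!fmapM q1b q2b fmapM.
  rewrite compmDr compmA compmDr !compmA bi1 bi2 -(compmA k1) te_sq.
  by rewrite !compmDl !compmA.
exists E, L, m, e; split.
- apply/DeltaP => /=; have := hK C (idm C) _ _ _ _ _ hT.
  by rewrite /= fmap1 compm1; apply; exact: mono_id.
- exact: injective_biproduct hS (injective_val iI) iK.
apply/(short_exactP abelian_te); have em : te_val e ∘ te_val m = 0.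
  by rewrite mE eE compmA bi1 -compmA (ker_comp kc) compm0.
have ke : is_kernel e m.
  apply/kernel_val; apply: is_kernelI => //.
    by rewrite mE; apply: mono_comp (split_mono (bip11 hS)) (ker_mono kc).
  move=> W g; rewrite eE => h.
  have := congr1 (compm q1) h; rewrite compm0 compmA q1b => g1.
  have := congr1 (compm q2) h; rewrite compm0 compmA q2b => g2.
  have [|v vE] := @ker_fac _ _ _ _ _ _ _ (p1 ∘ g) kc; first by rewrite compmA.
  exists v; apply: (bip_out hS); rewrite mE !compmA.
    by rewrite (bip11 hS) comp1m.
  by rewrite (bip21 hS) !comp0m g2.
split=> //; apply: epi_cokernel ke; first exact: abelian_te.
apply/epi_val; rewrite eE; apply: epi_of_eq0 => W g h.
have := congr1 (compm^~ i1) h; rewrite /= comp0m -compmA bi1 compmA => g1.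
have := congr1 (compm^~ i2) h; rewrite /= comp0m -compmA bi2 => g2.
apply: (bip_in hT); rewrite comp0m //.
exact: epi_eq0 (coker_epi cj) g1.
Qed.

(** * Finitistic dimensions *)

Lemma id_le0P (X : A) : id_le A 0 X <-> injectives A X.
Proof.
rewrite (id_le_opp abelian_te) injectives_opp.
exact: (pd_le0P (abelian_opp abelian_te)).
Qed.

(** This is what makes FPD and FID equal. If [X] is a counterexample on the projective side, so is
    its syzygy on the injective side: over [B] the presentation splits, so the syzygy has injective
    base, and were it injective in [A] the presentation would split there too. Cosyzygies give the
    converse. *)
Lemma projective_injective_te :
  (exists X : A, projectives B (te_base X) /\ ~ projectives A X) <->
  (exists X : A, injectives B (te_base X) /\ ~ injectives A X).
Proof.
split=> -[X [hX nX]]; apply: contrapT => /forallNP H; apply: nX.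
  have [P [p [pP pe]]] := enough_projectives_te X.
  have [K [k kp]] := epi_ses abelian_te pe.
  have /ses_val kpB := kp; have [s ps] := projective_section hX (ses_epi kpB).
  have [r rk] := ses_retraction kpB ps.
  have iK : injectives A K.
    apply: contrapT => nK; apply: (H K); split=> //.
    by apply: injective_retract rk _; rewrite -projinj; apply: projective_val.
  have [r' rk'] := injective_retraction iK (ses_mono kp).
  by have [s' ps'] := ses_section kp rk'; apply: projective_retract ps' pP.
have [I [m [iI mm]]] := enough_injectives_te X.
have [C [c mc]] := mono_ses abelian_te mm.
have /ses_val mcB := mc; have [r rm] := injective_retraction hX (ses_mono mcB).
have [s cs] := ses_section mcB rm.
have pC : projectives A C.
  apply: contrapT => nC; apply: (H C); split=> //.
  by apply: projective_retract cs _; rewrite projinj; apply: injective_val.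
have [s' cs'] := projective_section pC (ses_epi mc).
by have [r' rm'] := ses_retraction mc cs'; apply: injective_retract rm' iI.
Qed.

Lemma Uinv_pd_le1 : pd_le A 1 = Uinv F (projectives B).
Proof.
by apply/seteqP; split=> X; [move=> h; apply: pd_finite_val; exists 1%N|apply: pd_le1_te].
Qed.

Lemma Uinv_id_le1 : id_le A 1 = Uinv F (injectives B).
Proof.
by apply/seteqP; split=> X; [move=> h; apply: id_finite_val; exists 1%N|apply: id_le1_te].
Qed.

Lemma pd_finite_le1 : pd_finite A = pd_le A 1.
Proof.
by apply/seteqP; split=> X; [move/pd_finite_val/pd_le1_te|exists 1%N].
Qed.

Lemma id_finite_le1 : id_finite A = id_le A 1.
Proof.
by apply/seteqP; split=> X; [move/id_finite_val/id_le1_te|exists 1%N].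
Qed.

(** The truth value of [S 1], read as a number, is the supremum; this decides between dimensions 0
    and 1 classically. *)
Lemma supremums_le1 (S : set nat) : S 0%N -> (forall n, S n -> (n <= 1)%N) ->
  supremums S (`[< S 1%N >] : nat).
Proof.
move=> S0 S1; split=> [n Sn|n ubn]; rewrite leEnat.
  case: n Sn (S1 _ Sn) => [|[|n]] // Sn _.
  by have -> : `[< S 1%N >] = true by apply/asboolP.
by case: asboolP => // h; apply: ubn.
Qed.

Lemma FPD_FID_te : exists d : nat, [/\ FPD_is A d, FID_is A d & (d <= 1)%N].
Proof.
have [O zO] := zero_exists abelian_te.
pose SP := [set n | exists X : A, pd_finite A X /\ has_pd X n].
pose SI := [set n | exists X : A, id_finite A X /\ has_id X n].
have SP1 : SP 1%N <-> exists X : A, projectives B (te_base X) /\ ~ projectives A X.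
  split=> -[X [h1 h2]]; exists X; split.
  - exact: pd_finite_val.
  - by case: h2 => _ h /(pd_le0P abelian_te)/h.
  - by exists 1%N; apply: pd_le1_te.
  - by split=> [|[]//]; [apply: pd_le1_te|move=> /(pd_le0P abelian_te)].
have SI1 : SI 1%N <-> exists X : A, injectives B (te_base X) /\ ~ injectives A X.
  split=> -[X [h1 h2]]; exists X; split.
  - exact: id_finite_val.
  - by case: h2 => _ h /id_le0P/h.
  - by exists 1%N; apply: id_le1_te.
  - by split=> [|[]//]; [apply: id_le1_te|move=> /id_le0P].
exists (`[< SP 1%N >] : nat); split; last by case: asboolP.
  apply: supremums_le1 => [|n [X []]]; last by rewrite pd_finite_le1 => h [_]; apply.
  have h : pd_le A 0 O by apply/(pd_le0P abelian_te)/projective_zero.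
  by exists O; split; [exists 0%N|].
(* The candidate supremum was defined from [SP]; it also serves for FID because the two conditions
   coincide. *)
have -> : SP 1%N = SI 1%N.
  by apply/propext; rewrite SP1 SI1; exact: projective_injective_te.
apply: supremums_le1 => [|n [X []]]; last by rewrite id_finite_le1 => h [_]; apply.
have h : id_le A 0 O.
  apply/id_le0P; rewrite injectives_opp; apply: projective_zero.
  by case: zO.
by exists O; split; [exists 0%N|].
Qed.

(** * Orthogonal classes and the final assembly *)

Lemma lperp_Uinv : lperp (Uinv F (injectives B)) = Delta F [set: B].
Proof.
apply/seteqP; split=> X; first by move=> h; apply/DeltaP/Delta_of_Ext_zero.
by move=> /DeltaP mX Y iY; apply: Delta_Ext_zero.
Qed.

Lemma rperp_Delta : rperp (Delta F [set: B]) = Uinv F (injectives B).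
Proof.
apply/seteqP; split=> Y.
  by move=> h; apply: injective_of_Ext_zero => X /DeltaP; apply: h.
by move=> iY X /DeltaP mX; apply: Delta_Ext_zero.
Qed.

End TrivialExtension.

Theorem theorem3p16 (B : preadditive) (F : additive_functor B B)
    (G : functor B B)
    (frobB : frobenius B)
    (exactF : exact_functor F)
    (F2_0 : forall X : B, zero_object (F (F X)))
    (projF : preserves_projectives F)
    (adjFG : adjoint F G) :
  let A := trivial_extension F in
  let DeltaB := Delta F [set: B] in
  let Uinj := Uinv F (injectives B) in
  ([/\ abelian A, enough_projectives A, enough_injectives A & gorenstein A]
   /\ (exists d : nat, [/\ FPD_is A d, FID_is A d & (d <= 1)%N])
   /\ (pd_finite A = pd_le A 1
       /\ pd_le A 1 = Uinv F (projectives B)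
       /\ Uinv F (projectives B) = Uinv F (injectives B)
       /\ Uinv F (injectives B) = id_le A 1
       /\ id_le A 1 = id_finite A))
  /\
  ((lperp Uinj, Uinj) = (DeltaB, rperp DeltaB)
   /\ (DeltaB, rperp DeltaB) = (GP A, pd_le A 1)
   /\ [/\ cotorsion_pair (GP A, pd_le A 1), hereditary (GP A, pd_le A 1)
        & complete (GP A, pd_le A 1)]
   /\ GP A = DeltaB).
Proof.
move=> A DeltaB Uinj.
have [phi [phi_bij phi_nat]] := adjFG.
have phi_comp (X X' Y : B) (h : hom (F X) Y) (f : hom X' X) :
    phi X' Y (h ∘ fmap F f)%R = (phi X Y h ∘ f)%R.
  (* Naturality in the source is the case in which the map between targets is the identity, which
     both functors preserve. *)
  by have := phi_nat X X' Y Y f h (idm Y); rewrite fmap1 !comp1m.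
have [abB _ _ PI] := frobB.
have E1 := Uinv_pd_le1 frobB F2_0 projF phi_bij phi_comp.
have E2 := Uinv_id_le1 frobB exactF F2_0 phi_bij phi_comp.
have lU := lperp_Uinv frobB exactF F2_0 projF phi_bij phi_comp.
have rD := rperp_Delta frobB exactF F2_0 projF phi_bij phi_comp.
have E3 : pd_le A 1 = Uinj by rewrite E1 PI.
have gp := GP_Delta frobB exactF F2_0 projF phi_bij phi_comp.
split; split.
- split.
  + exact (abelian_te frobB F2_0 phi_bij phi_comp).
  + exact (enough_projectives_te frobB F2_0 phi_bij phi_comp).
  + exact (enough_injectives_te frobB F2_0 phi_bij phi_comp).
  + split; exists 1%N => I.
      by move=> /(injective_val frobB exactF F2_0 phi_bij phi_comp) iI; rewrite E3.
    move=> /(projective_val frobB F2_0 projF phi_bij phi_comp) pI.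
    by rewrite E2 -PI.
- split; first exact (FPD_FID_te frobB exactF F2_0 projF phi_bij phi_comp).
  rewrite (pd_finite_le1 frobB F2_0 projF phi_bij phi_comp).
  by rewrite (id_finite_le1 frobB exactF F2_0 phi_bij phi_comp) E1 E2 PI.
- by rewrite lU rD.
- split; first by rewrite gp rD E3.
  split; last exact: gp.
  rewrite gp E3; split.
  + by split; rewrite /= ?lU ?rD.
  + move=> i X Y i1 /(DeltaP frobB) mX iY.
    exact (Delta_Ext_zero frobB exactF F2_0 projF phi_bij phi_comp i1 mX iY).
  + exact (complete_Delta frobB exactF F2_0 projF phi_bij phi_comp).
Qed.
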